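(* Fix one of the tensor formats HOSVD, TT, or HT (with binary dimension tree $T_I$) and a rank tuple $\mathbf r$. Let $n=\max_{i\in[d]}n_i$ and $r=\max_t r_t$ (maximum over the entries of $\mathbf r$). Let $\delta,\varepsilon\in(0,1)$ and let $\mathcal A:\mathbb R^{n_1\times\cdots\times n_d}\to\mathbb R^m$ be an $L$-subgaussian measurement ensemble. Then $\delta_{\mathbf r}\le\delta$ with probability at least $1-\varepsilon$ provided that $$\text{HOSVD:}\quad m\ge C_1\delta^{-2}\max\{(r^d+dnr)\log d,\ \log(\varepsilon^{-1})\},$$ $$\text{TT and HT:}\quad m\ge C_2\delta^{-2}\max\{((d-1)r^3+dnr)\log(dr),\ \log(\varepsilon^{-1})\},$$ where $C_1,C_2>0$ depend only on $L$.
   Context: A random variable $\xi$ is $L$-subgaussian if $\mathbb E\exp(t\xi)\le\exp(L^2t^2/2)$ for all $t\in\mathbb R$. An $L$-subgaussian measurement ensemble is the map $\mathcal A(\mathbf X)_i=\frac1{\sqrt m}\langle\mathbf A_i,\mathbf X\rangle$, $i\in[m]$, where all entries of all tensors $\mathbf A_i\in\mathbb R^{n_1\times\cdots\times n_d}$ are independent, mean-zero, variance-one, $L$-subgaussian random variables. Here $d\ge2$. Ranks: HOSVD-rank $(r_1,\dots,r_d)$ with $r_k=\operatorname{rank}\mathbf X^{\{k\}}$ (mode-$k$ matricization); for a binary dimension tree $T_I$ (tree of subsets of $[d]$, root $[d]$, leaves $\{1\},\dots,\{d\}$, each interior node the disjoint union of its two sons) the HT-rank is $(r_\alpha)_{\alpha\in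 T_I}$, $r_\alpha=\operatorname{rank}\mathbf X^\alpha$, where $\mathbf X^{\alpha}$ is the matricization with row indices in $\alpha$ and column indices in $[d]\setminus\alpha$; TT is the HT case for the tree with nodes $\{i,\dots,d\}$, $\{i\}$. The tensor restricted isometry constant $\delta_{\mathbf r}$ is the smallest $\delta\ge0$ such that $(1-\delta)\|\mathbf X\|_F^2\le\|\mathcal A(\mathbf X)\|_2^2\le(1+\delta)\|\mathbf X\|_F^2$ for all $\mathbf X$ of rank at most $\mathbf r$ (componentwise) in the given format; $\|\cdot\|_F$ is the entrywise Euclidean norm. *)

(* Defs.v *)
From HB Require Import structures.
From mathcomp Require Import all_boot all_order all_algebra.
From mathcomp Require Import all_classical all_reals all_analysis.
Set Implicit Arguments. Unset Strict Implicit. Unset Printing Implicit Defensive.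
Import Order.TTheory GRing.Theory Num.Theory.
Local Open Scope ring_scope.

Definition idx (d : nat) (n : 'I_d -> nat) : finType :=
  {dffun forall k : 'I_d, 'I_(n k)}.

Definition rowIdx (d : nat) (n : 'I_d -> nat) (alpha : {set 'I_d}) : finType :=
  {dffun forall s : {k : 'I_d | k \in alpha}, 'I_(n (sval s))}.
Definition colIdx (d : nat) (n : 'I_d -> nat) (alpha : {set 'I_d}) : finType :=
  {dffun forall s : {k : 'I_d | k \notin alpha}, 'I_(n (sval s))}.

Definition merge (d : nat) (n : 'I_d -> nat) (alpha : {set 'I_d})
  (i : rowIdx n alpha) (j : colIdx n alpha) : idx n :=
  [ffun k : 'I_d =>
     (if k \in alpha as b return ((k \in alpha) = b -> 'I_(n k))
      then fun h => i (exist (fun k => k \in alpha) k h)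
      else fun h => j (exist (fun k => k \notin alpha) k (negbT h))) (erefl _)].

Definition matricization (R : fieldType) (d : nat) (n : 'I_d -> nat)
  (alpha : {set 'I_d}) (X : idx n -> R)
  : 'M[R]_(#|{: rowIdx n alpha}|, #|{: colIdx n alpha}|) :=
  \matrix_(i, j) X (merge (enum_val i) (enum_val j)).

Definition mrank (R : fieldType) (d : nat) (n : 'I_d -> nat)
  (alpha : {set 'I_d}) (X : idx n -> R) : nat :=
  \rank (matricization alpha X).

(* Binary dimension trees, given by their node sets. *)
Definition is_dim_tree (d : nat) (T : {set {set 'I_d}}) : Prop :=
  [/\ [set: 'I_d] \in T,
      (forall k : 'I_d, [set k] \in T),
      finset.set0 \notin T,
      (forall t s, t \in T -> s \in T ->
         [|| t \subset s, s \subset t | [disjoint t & s]]) &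
      (forall t, t \in T -> (1 < #|t|)%N ->
         exists t1 t2, [/\ t1 \in T, t2 \in T, [disjoint t1 & t2] &
                           t1 :|: t2 = t])].

Inductive tformat (d : nat) :=
| HOSVD
| TT
| HT of {set {set 'I_d}}.

Definition valid_format (d : nat) (f : tformat d) : Prop :=
  match f with HT T => is_dim_tree T | _ => True end.

Definition format_nodes (d : nat) (f : tformat d) : {set {set 'I_d}} :=
  match f with
  | HOSVD => [set [set k] | k : 'I_d]
  | TT => [set [set j : 'I_d | (i <= j)%N] | i : 'I_d] :|: [set [set i] | i : 'I_d]
  | HT T => T
  end.

Definition low_rank (R : fieldType) (d : nat) (n : 'I_d -> nat) (f : tformat d)
  (r : {set 'I_d} -> nat) (X : idx n -> R) : Prop :=
  forall alpha, alpha \in format_nodes f -> (mrank alpha X <= r alpha)%N.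

Definition rmax (d : nat) (f : tformat d) (r : {set 'I_d} -> nat) : nat :=
  (\max_(t in format_nodes f) r t)%N.

Definition fro2 (R : realType) (d : nat) (n : 'I_d -> nat) (X : idx n -> R) : R :=
  \sum_(j : idx n) X j ^+ 2.

Definition meas2 (R : realType) (T : Type) (d : nat) (n : 'I_d -> nat) (m : nat)
  (A : 'I_m -> idx n -> T -> R) (w : T) (X : idx n -> R) : R :=
  \sum_(i < m) ((Num.sqrt (m%:R))^-1 * \sum_(j : idx n) A i j w * X j) ^+ 2.

Local Open Scope classical_set_scope.

Definition tric (R : realType) (T : Type) (d : nat) (n : 'I_d -> nat) (m : nat)
  (f : tformat d) (r : {set 'I_d} -> nat) (A : 'I_m -> idx n -> T -> R) (w : T) : R :=
  inf [set dl : R | 0 <= dl /\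
        forall X : idx n -> R, low_rank f r X ->
          (1 - dl) * fro2 X <= meas2 A w X /\ meas2 A w X <= (1 + dl) * fro2 X].

Definition mutually_independent (R : realType) (dT : measure_display)
  (T : measurableType dT) (P : probability T R) (J : finType) (xi : J -> T -> R) : Prop :=
  forall B : J -> set R, (forall j, measurable (B j)) ->
    P (\bigcap_(j in [set: J]) (xi j @^-1` B j)) = (\prod_(j : J) P (xi j @^-1` B j))%E.

Definition subgaussian (R : realType) (dT : measure_display)
  (T : measurableType dT) (P : probability T R) (L : R) (xi : T -> R) : Prop :=
  forall t : R,
    (\int[P]_w (expR (t * xi w))%:E <= (expR (L ^+ 2 * t ^+ 2 / 2))%:E)%E.

Definition subgaussian_ensemble (R : realType) (dT : measure_display)
  (T : measurableType dT) (P : probability T R) (L : R) (d : nat) (n : 'I_d -> nat)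
  (m : nat) (A : 'I_m -> idx n -> T -> R) : Prop :=
  [/\ (forall i j, measurable_fun [set: T] (A i j)),
      mutually_independent P (fun p : 'I_m * idx n => A p.1 p.2),
      (forall i j, (\int[P]_w (A i j w)%:E = 0)%E),
      (forall i j, (\int[P]_w ((A i j w) ^+ 2)%:E = 1)%E) &
      (forall i j, subgaussian P L (A i j))].

Definition nmax (d : nat) (n : 'I_d -> nat) : nat := (\max_(k : 'I_d) n k)%N.

Definition sample_bound (R : realType) (d : nat) (n : 'I_d -> nat) (f : tformat d)
  (r : {set 'I_d} -> nat) (C1 C2 dl eps : R) : R :=
  let rr := rmax f r in
  let nn := nmax n in
  match f with
  | HOSVD => C1 / dl ^+ 2 *
      Num.max (((rr ^ d + d * nn * rr)%N)%:R * ln (d%:R)) (ln (eps^-1))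
  | _ => C2 / dl ^+ 2 *
      Num.max ((((d - 1) * rr ^ 3 + d * nn * rr)%N)%:R * ln ((d * rr)%N%:R))
              (ln (eps^-1))
  end.

(* Main.v *)
(* Write b(X, Y) = <A X, A Y> - <X, Y>.  By hierarchical orthogonal projections, a
   low-rank tensor of norm at most one is a multilinear image of at most 2d
   contractions: one frame per mode, and one transfer tensor per interior node (or
   a single core tensor for HOSVD).  Quantize each contraction in operator norm
   with precision of order 1/d.  If all factors of X and X' fall in the same cells,
   telescoping puts X - X' into 1/4 of the absolutely convex hull of the class.
   Since b is bilinear, sup |b| <= max over the net |b| + (1/2) sup |b|, so the
   precision need not depend on delta: this is what avoids a factor log(1/delta)
   without chaining.  On the net, polarization reduces b to |A X|^2 - |X|^2, which
   is controlled by Bernstein's inequality for squares of subgaussian variables,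
   and a union bound over (C d)^(2 dim) pairs gives the sample complexity (in the
   tree formats even with log d in place of log (d r)). *)

Require Import Defs.
From HB Require Import structures.
From mathcomp Require Import all_boot all_order all_algebra.
From mathcomp Require Import all_classical all_reals all_analysis.
From mathcomp Require Import measurable_realfun.
From mathcomp Require Import zify ring lra.
Import Order.TTheory GRing.Theory Num.Theory.
Local Open Scope classical_set_scope.
Local Open Scope ring_scope.
Set Implicit Arguments.
Unset Strict Implicit.
Unset Printing Implicit Defensive.

(** * Quantization of convex classes *)

(** The low-rank class is not closed under subtraction, which is why hulls appear. In a multilinear
    parametrization by contractions, the difference of two factors from the same cell is [e] times
    another contraction, so each term of the telescoping sum is [e] times a member of the class.
    Operator norm is the right size for the factors: products and Kronecker products of contractions
    are contractions, so a tensor may carry its whole norm in the root factor and no singular values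
    have to be controlled. The obstacle is that nodes of a tree have row indices of different types.
    Every frame is therefore a function on all of [idx n] that is constant in the coordinates
    outside its node; tensor products and projections then share one row type, and averaging over
    the idle coordinates replaces all reindexing. *)

(** [g a x] reads: the norm of [x] is at most [a]. As a relation, an operator norm enters through
    its defining inequality and no supremum is evaluated. The last two fields compare with the
    maximum norm: one bounds rounding errors, the other makes the lattice points of a ball finite in
    number. *)
Record relnorm (R : realType) (J : finType) (g : R -> (J -> R) -> Prop) : Prop :=
  RelNorm {
    relnorm_mono : forall a b x, g a x -> a <= b -> g b x;
    relnormD : forall a b x y, g a x -> g b y -> g (a + b) (fun j => x j + y j);
    relnormZ : forall a t x, g a x -> g (`|t| * a) (fun j => t * x j);
    relnorm_cube : exists2 C : R, 0 < C &
      forall h u, 0 <= h -> (forall j, `|u j| <= h) -> g (C * h) u;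
    relnorm_coord : exists2 C : R, 0 < C &
      forall a x, g a x -> forall j, `|x j| <= C * a }.

(* Replaces the volume comparison for balls: with [A] the points of a fine
   lattice in the ball of radius [e / 4], division with remainder by [k] maps
   the lattice points [X_i + a], [a \in A], injectively into residues times [A]. *)
Lemma separated_card (R : realType) (J : finType) (g : R -> (J -> R) -> Prop)
    (e : R) (k M : nat) (X : 'I_M -> J -> R) :
  relnorm g -> 0 < e <= 1 -> 7 <= k%:R * e ->
  (forall i, g 1 (X i)) ->
  (forall i i', i != i' -> ~ g e (fun j => X i j - X i' j)) ->
  (M <= k ^ #|J|)%N.
Proof.
move=> [gmono gD gZ [C1 C1_gt0 gcube] [C2 C2_gt0 gcoord]] /andP[e_gt0 e_le1].
case: k => [|k] ke7 gX sepX; first by rewrite mul0r in ke7; lra.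
(* Mesh for which rounding to the lattice, or dropping a remainder, costs at most [e / 16] in
   norm. *)
pose h := e / (16 * C1).
have h_gt0 : 0 < h by rewrite divr_gt0 // mulr_gt0.
have C1h : C1 * h = e / 16 by rewrite /h; field; lra.
have gN a x : g a x -> g a (fun j => - x j).
  move=> /(gZ _ (-1)); rewrite normrN normr1 mul1r.
  by congr (g _ _); apply/funext => j; rewrite mulN1r.
have gsmall u : (forall j, `|u j| <= h) -> g (e / 16) u.
  by move=> uh; rewrite -C1h; apply: gcube => //; exact: ltW.
pose rd (x : J -> R) j : int := Num.floor (x j / h).
have grd x : g (e / 16) (fun j => x j - h * (rd x j)%:~R).
  apply: gsmall => j; have /andP[] := floor_itv (x j / h); rewrite -/(rd x j).
  rewrite intrD ler_pdivlMr // ltr_pdivrMr // => l1 l2.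
  by rewrite ger0_norm; lra.
(* The range from [-w] to [w] contains the coordinates of all lattice points of norm at most
   [e / 4], so [A] misses none of them. *)
pose w := (Num.truncn (C2 * (e / 4) / h)).+1.
have wP (y : int) : `|h * y%:~R| <= C2 * (e / 4) -> (`|y| <= w%:Z).
  rewrite normrM gtr0_norm // mulrC -ler_pdivlMr // => yw.
  rewrite -(ler_int R) intr_norm; apply: le_trans yw _.
  by rewrite -pmulrn ltW // truncnS_gt.
pose W := (w + w)%N.
pose pt (a : {ffun J -> 'I_W.+1}) j : int := (a j : nat)%:Z - w%:Z.
pose A := [set a : {ffun J -> 'I_W.+1} |
   `[< g (e / 4) (fun j => h * (pt a j)%:~R) >]]%SET.
have A_gt0 : (0 < #|A|)%N.
  apply/card_gt0P; exists [ffun j => inord w].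
  rewrite inE; apply/asboolP; apply: (gmono (C1 * 0)); last by rewrite mulr0; lra.
  apply: gcube => // j; rewrite /pt ffunE inordK ?subrr ?mulr0 ?normr0 //.
  by rewrite ltnS /W leq_addr.
pose z i (a : {ffun J -> 'I_W.+1}) j : int := rd (X i) j + pt a j.
pose y i a j := (z i a j %/ k.+1)%Z.
have gz i a : a \in A -> g (1 + e / 16 + e / 4) (fun j => h * (z i a j)%:~R).
  rewrite inE => /asboolP ga.
  have := gD _ _ _ _ (gD _ _ _ _ (gX i) (gN _ _ (grd (X i)))) ga.
  congr (g _ _); apply/funext => j; rewrite /z intrD; ring.
have k_gt0 : 0 < k.+1%:R :> R by rewrite ltr0n.
have gy i a : a \in A -> g (e / 4) (fun j => h * (y i a j)%:~R).
  move=> aA.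
  pose df j : R := h * ((z i a j %% k.+1)%Z%:~R / k.+1%:R).
  have gdf : g (e / 16) df.
    apply: gsmall => j.
    have m0 : 0 <= (z i a j %% k.+1)%Z by exact: modz_ge0.
    have m1 : (z i a j %% k.+1)%Z < k.+1 by exact: ltz_pmod.
    have d0 : 0 <= (z i a j %% k.+1)%Z%:~R / k.+1%:R :> R.
      by rewrite divr_ge0 // ler0z.
    have d1 : (z i a j %% k.+1)%Z%:~R / k.+1%:R <= 1 :> R.
      rewrite ler_pdivrMr // mul1r -[k.+1%:R]/(k.+1%:Z%:~R) ler_int; exact: ltW.
    rewrite /df ger0_norm; last by apply: mulr_ge0 => //; exact: ltW.
    by rewrite -[leRHS]mulr1 ler_pM2l.
  have G := gD _ _ _ _ (gZ _ (k.+1%:R^-1) _ (gz i a aA)) (gN _ _ gdf).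
  have le : `|k.+1%:R^-1| * (1 + e / 16 + e / 4) + e / 16 <= e / 4.
    rewrite gtr0_norm ?invr_gt0 // [k.+1%:R^-1 * _]mulrC.
    (* The constant 7 enters here: [3 * 7 / 16 = 1 + 5 / 16], and [e <= 1]. Together with [e / 16]
       for the remainder, the quotient has norm at most [e / 4], so it is again a point of [A]. *)
    have : (1 + e / 16 + e / 4) / k.+1%:R <= e * 3 / 16; last first.
      by rewrite -!mulrA; set q := _ * _^-1 => ?; lra.
    by rewrite ler_pdivrMr //; lra.
  have := gmono _ _ _ G le; congr (g _ _).
  apply/funext => j.
  have zE : (z i a j)%:~R =
      (y i a j)%:~R * k.+1%:R + (z i a j %% k.+1)%Z%:~R :> R.
    by rewrite {1}(divz_eq (z i a j) k.+1) intrD intrM.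
  by rewrite /df zE; field; lra.
have yw i a j : a \in A -> (`|y i a j| <= w%:Z).
  by move=> aA; apply: wP; exact: (gcoord _ _ (gy i a aA)).
pose f (p : 'I_M * {ffun J -> 'I_W.+1}) : {ffun J -> 'I_k.+1} * {ffun J -> 'I_W.+1} :=
  ([ffun j => inord (absz (z p.1 p.2 j %% k.+1)%Z)],
   [ffun j => inord (absz (y p.1 p.2 j + w%:Z)%R)]).
have ptf i a : a \in A -> forall j, pt (f (i, a)).2 j = y i a j.
  move=> aA j; rewrite /pt /= ffunE inordK; have := yw i a j aA; rewrite /W; lia.
pose D := finset.setX [set: 'I_M]%SET A.
(* Residue and quotient determine [z]. If [z] agrees for [i] and [i'], then [X i - X i'] has norm at
   most [5 * e / 8], which separation forbids unless [i = i']; then the lattice points agree too. *)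
have finj : {in D &, injective f}.
  move=> [i a] [i' a'] /finset.setXP[/= _ aA] /finset.setXP[/= _ a'A] ff.
  have zz j : z i a j = z i' a' j.
    rewrite (divz_eq (z i a j) k.+1) (divz_eq (z i' a' j) k.+1).
    rewrite -[(z i a j %/ _)%Z]/(y i a j) -[(z i' a' j %/ _)%Z]/(y i' a' j).
    rewrite -(ptf i a aA) -(ptf i' a' a'A) ff; congr (_ + _).
    have := congr1 (fun p : {ffun J -> 'I_k.+1} * {ffun J -> 'I_W.+1} => val (p.1 j)) ff.
    rewrite /f /= !ffunE /=.
    have m0 b c : 0 <= (z b c j %% k.+1)%Z by exact: modz_ge0.
    have m1 b c : (z b c j %% k.+1)%Z < k.+1 by exact: ltz_pmod.
    have := m0 i a; have := m1 i a; have := m0 i' a'; have := m1 i' a'.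
    move: (z i a j %% k.+1)%Z (z i' a' j %% k.+1)%Z => u v u1 u0 v1 v0.
    by rewrite !inordK; lia.
  have ii : i = i'.
    apply: contrapT => /eqP /sepX; apply.
    have := aA; rewrite inE => /asboolP ga.
    have := a'A; rewrite inE => /asboolP ga'.
    have G := gD _ _ _ _ (gD _ _ _ _ (grd (X i)) (gN _ _ (grd (X i'))))
                         (gD _ _ _ _ ga' (gN _ _ ga)).
    have le : e / 16 + e / 16 + (e / 4 + e / 4) <= e by lra.
    have := gmono _ _ _ G le; congr (g _ _).
    apply/funext => j.
    have := congr1 (fun v : int => v%:~R : R) (zz j); rewrite /z.
    move: (pt a j) (pt a' j) => u v; rewrite !intrD => eqz.
    have -> : v%:~R = (rd (X i) j)%:~R + u%:~R - (rd (X i') j)%:~R :> R.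
      by rewrite eqz; ring.
    ring.
  congr (_, _) => //; apply/ffunP => j; apply/val_inj => /=.
  by have := zz j; rewrite ii /z /pt; lia.
(* The positive factor [#|A|] occurs on both sides and cancels, so [A] never has to be counted. *)
have : (#|f @: D| <= #|finset.setX [set: {ffun J -> 'I_k.+1}]%SET A|)%N.
  apply: subset_leq_card; apply/fintype.subsetP => _ /imsetP[[i a] /finset.setXP[/= _ aA] ->].
  apply/finset.setXP; split; first by rewrite inE.
  rewrite inE; apply/asboolP; have := gy i a aA; congr (g _ _).
  by apply/funext => j; rewrite -(ptf i a aA).
rewrite card_in_imset // !cardsX !cardsT card_ord card_ffun card_ord leq_pmul2r //.
Qed.

Definition dotp (R : realType) (J : finType) (w x : J -> R) : R :=
  \sum_j w j * x j.

(* [quantizable F e N]: F splits into N pieces such that the difference of two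
   elements of a piece lies in e times the absolutely convex hull of F; the
   hull is expressed by duality, which turns images of product sets under
   bilinear maps into a formality. *)
Definition quantizable (R : realType) (J : finType) (F : set (J -> R)) (e : R)
    (N : nat) : Prop :=
  exists I : finType, exists2 q : (J -> R) -> I, (#|I| <= N)%N &
    forall x y, F x -> F y -> q x = q y ->
    forall (w : J -> R) (b : R), (forall f, F f -> `|dotp w f| <= b) ->
      `|dotp w x - dotp w y| <= e * b.

Lemma quantizable_le (R : realType) (J : finType) (F : set (J -> R)) (e e' : R)
    (N N' : nat) :
  quantizable F e N -> e <= e' -> (N <= N')%N -> quantizable F e' N'.
Proof.
move=> [I [q cI qP]] ee NN; exists I; exists q; first exact: leq_trans cI NN.
move=> x y Fx Fy qxy w b wb; apply: le_trans (qP x y Fx Fy qxy w b wb) _.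
by rewrite ler_wpM2r //; apply: le_trans (wb x Fx).
Qed.

(** A maximal [e / 2]-separated family is an [e / 2]-net, and two points near the same centre differ
    by [e] times a point of the ball. Separation at [e / 2] turns the 7 of [separated_card] into
    14. *)
Lemma quantizable_ball (R : realType) (J : finType) (g : R -> (J -> R) -> Prop)
    (e : R) (k : nat) :
  relnorm g -> 0 < e <= 1 -> 14 <= k%:R * e ->
  quantizable (g 1) e (k ^ #|J|).
Proof.
move=> ng /andP[e0 e1] ke.
pose sep M := `[< exists X : 'I_M -> J -> R, (forall i, g 1 (X i)) /\
  (forall i i', i != i' -> ~ g (e / 2) (fun j => X i j - X i' j)) >].
have sepB M : sep M -> (M <= k ^ #|J|)%N.
  move=> /asboolP[X [gX sX]].
  by apply: (separated_card ng (e := e / 2) (X := X)) => //; lra.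
have sep0 : exists M, sep M.
  exists 0; apply/asboolP; exists (fun=> fun=> 0); split=> -[] //.
case: (ex_maxnP sep0 sepB) => M /asboolP[X [gX sX]] maxM.
have gN a x : g a x -> g a (fun j => - x j).
  move=> /(relnormZ ng (-1)); rewrite normrN normr1 mul1r.
  by congr (g _ _); apply/funext => j; rewrite mulN1r.
have near x : g 1 x -> exists i, g (e / 2) (fun j => x j - X i j).
  move=> gx; apply: contrapT => noi.
  suff /maxM : sep M.+1 by rewrite ltnn.
  apply/asboolP; exists (fun i => if unlift ord0 i is Some i' then X i' else x).
  split=> [i|i i']; first by case: unliftP.
  case: unliftP => [j ->|->]; case: unliftP => [j' ->|->].
  - by move=> jj; apply: sX; apply: contra_neq jj => ->.
  - move=> _ /gN gx'; apply: noi; exists j; congr (g _ _): gx'.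
    by apply/funext => l; rewrite opprB.
  - by move=> _ gx'; apply: noi; exists j'.
  - by rewrite eqxx.
pose q x : option 'I_M := [pick i | `[< g (e / 2) (fun j => x j - X i j) >]].
case: M X gX sX maxM near @q => [|M] X gX sX maxM near q.
  exists unit; exists (fun=> tt).
    rewrite card_unit expn_gt0; case: k ke {sepB maxM} => //; rewrite mul0r; lra.
  by move=> x y /near[[]].
exists 'I_M.+1; exists (fun x => odflt ord0 (q x)).
  by rewrite card_ord sepB //; apply/asboolP; exists X.
move=> x y gx gy; rewrite /q.
case: pickP => [i /asboolP gi|/(_ _)]; last first.
  by have [i gi] := near x gx => /(_ i) /asboolP.
case: pickP => [i' /asboolP gi'|/(_ _)]; last first.
  by have [i' gi'] := near y gy => /(_ i') /asboolP.
move=> /= ii w b wb; rewrite -{}ii in gi'.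
have := relnormD ng gi (gN _ _ gi').
set u := fun j => _; rewrite -splitr => gu.
have -> : dotp w x - dotp w y = dotp w u.
  rewrite /dotp -sumrB; apply: eq_bigr => j _; rewrite /u; ring.
have := relnormZ ng e^-1 gu; rewrite gtr0_norm ?invr_gt0 // mulVf ?gt_eqF //.
move=> /wb; set v := (X in `|X|).
have -> : v = e^-1 * dotp w u.
  by rewrite /v /dotp mulr_sumr; apply: eq_bigr => j _; rewrite mulrCA.
by rewrite normrM gtr0_norm ?invr_gt0 // ler_pdivrMl.
Qed.

(** Telescoping: [b x1 x2 - b y1 y2] changes one argument at a time. A functional bounded on the
    image stays bounded by the same number on a slice with the other argument fixed, so each change
    is covered by the hypothesis on one factor; precisions add and piece counts multiply. *)
Lemma quantizable_bilinear (R : realType) (J1 J2 J : finType)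
    (F1 : set (J1 -> R)) (F2 : set (J2 -> R)) (e1 e2 : R) (N1 N2 : nat)
    (b : (J1 -> R) -> (J2 -> R) -> J -> R) :
  (forall w y, exists w1, forall x, dotp w (b x y) = dotp w1 x) ->
  (forall w x, exists w2, forall y, dotp w (b x y) = dotp w2 y) ->
  quantizable F1 e1 N1 -> quantizable F2 e2 N2 ->
  quantizable [set z | exists x y, [/\ F1 x, F2 y & z = b x y]] (e1 + e2) (N1 * N2).
Proof.
move=> bl br [I1 [q1 c1 q1P]] [I2 [q2 c2 q2P]].
pose F := [set z | exists x y, [/\ F1 x, F2 y & z = b x y]].
have ch z : exists xy : (J1 -> R) * (J2 -> R),
    F z -> [/\ F1 xy.1, F2 xy.2 & z = b xy.1 xy.2].
  have [[x [y Fxy]]|nF] := pselect (F z); first by exists (x, y).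
  by exists (fun=> 0, fun=> 0).
pose s z := projT1 (cid (ch z)).
have sP z : F z -> [/\ F1 (s z).1, F2 (s z).2 & z = b (s z).1 (s z).2].
  by rewrite /s; case: cid.
exists (I1 * I2)%type; exists (fun z => (q1 (s z).1, q2 (s z).2)).
  by rewrite card_prod leq_mul.
move=> x y /sP[F1x F2x xE] /sP[F1y F2y yE] [qx qy] w B wB.
rewrite xE yE; move: F1x F2x F1y F2y qx qy {xE yE}.
move: (s x).1 (s x).2 (s y).1 (s y).2 => x1 x2 y1 y2 F1x F2x F1y F2y qx qy.
have [w1 w1P] := bl w x2; have [w2 w2P] := br w y1.
have l1 : `|dotp w1 x1 - dotp w1 y1| <= e1 * B.
  by apply: q1P => // f Ff; rewrite -w1P; apply: wB; exists f, x2.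
have l2 : `|dotp w2 x2 - dotp w2 y2| <= e2 * B.
  by apply: q2P => // f Ff; rewrite -w2P; apply: wB; exists y1, f.
have -> : dotp w (b x1 x2) - dotp w (b y1 y2) =
    (dotp w1 x1 - dotp w1 y1) + (dotp w2 x2 - dotp w2 y2).
  by rewrite -!w1P -!w2P; ring.
by rewrite mulrDl (le_trans (ler_normD _ _)) // lerD.
Qed.

(* The weight [s] lets frames live on all of [idx n] while depending only on
   some of the coordinates: a column is then normalized to [#|idx n|]. *)
Definition frame (R : realType) (I L : finType) (s : R) (U : I * L -> R) : Prop :=
  forall c : L -> R, \sum_i (\sum_l c l * U (i, l)) ^+ 2 <= s * \sum_l c l ^+ 2.

(** The operator norm of the pullback of [V] along [p], seen as a norm of [V] itself. It lives on
    [I * L], so net sizes are governed by the small index type [I] and not by [I']. *)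
Definition frame_pull (R : realType) (I' I L : finType) (p : I' -> I) (s a : R)
    (V : I * L -> R) : Prop :=
  0 <= a /\ frame (s * a ^+ 2) (fun il : I' * L => V (p il.1, il.2)).

Lemma sqr_sum_le (R : realType) (I : finType) (F G : I -> R) :
  (\sum_i F i * G i) ^+ 2 <= (\sum_i F i ^+ 2) * \sum_i G i ^+ 2.
Proof.
set S := \sum_i F i * G i; set A := \sum_i F i ^+ 2; set B := \sum_i G i ^+ 2.
have q t : 0 <= t ^+ 2 * A + (t *+ 2) * S + B.
  have -> : t ^+ 2 * A + (t *+ 2) * S + B = \sum_i (t * F i + G i) ^+ 2.
    rewrite !mulr_sumr -!big_split /=; apply: eq_bigr => i _; ring.
  by apply: sumr_ge0 => i _; exact: sqr_ge0.
have A0 : 0 <= A by apply: sumr_ge0 => i _; exact: sqr_ge0.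
have B0 : 0 <= B by apply: sumr_ge0 => i _; exact: sqr_ge0.
have [A_eq0|A_neq0] := eqVneq A 0.
  have F0 i : F i = 0.
    apply/eqP; rewrite -sqrf_eq0; move/eqP: A_eq0; rewrite /A psumr_eq0.
      by move=> /allP/(_ i (mem_index_enum i)).
    by move=> j _; exact: sqr_ge0.
  by rewrite A_eq0 mul0r /S big1 ?expr0n // => i _; rewrite F0 mul0r.
have A_gt0 : 0 < A by rewrite lt_neqAle eq_sym A_neq0.
have := q (- S / A).
have -> : (- S / A) ^+ 2 * A + (- S / A) *+ 2 * S + B = (A * B - S ^+ 2) / A.
  by field.
by rewrite pmulr_lge0 ?invr_gt0 // subr_ge0.
Qed.

Lemma sum_sqrD_le (R : realType) (I : finType) (F G : I -> R) (a b : R) :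
  0 <= a -> 0 <= b -> \sum_i F i ^+ 2 <= a ^+ 2 -> \sum_i G i ^+ 2 <= b ^+ 2 ->
  \sum_i (F i + G i) ^+ 2 <= (a + b) ^+ 2.
Proof.
move=> a0 b0 Fa Gb.
have -> : \sum_i (F i + G i) ^+ 2 =
    \sum_i F i ^+ 2 + (\sum_i F i * G i) *+ 2 + \sum_i G i ^+ 2.
  rewrite -sumrMnl -!big_split /=; apply: eq_bigr => i _; ring.
have : \sum_i F i * G i <= a * b.
  apply: le_trans (ler_norm _) _.
  rewrite -ler_sqr ?nnegrE ?mulr_ge0 // real_normK ?num_real // exprMn.
  apply: le_trans (sqr_sum_le F G) _; apply: ler_pM => //; apply: sumr_ge0 => i _; exact: sqr_ge0.
move=> ?; rewrite sqrrD; lra.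
Qed.

(** Minkowski gives the sum and Cauchy-Schwarz the bound on a cube. Entries are bounded by testing
    on unit vectors, where surjectivity of [p] ensures that each entry is seen. *)
Lemma relnorm_frame_pull (R : realType) (I' I L : finType) (p : I' -> I) (s : R) :
  0 < s -> (forall i, exists i', p i' = i) ->
  relnorm (frame_pull (L := L) p s).
Proof.
move=> s_gt0 psurj.
have sc0 (c : L -> R) : 0 <= \sum_l c l ^+ 2.
  by apply: sumr_ge0 => i _; exact: sqr_ge0.
split.
- move=> a b x [a0 fx] ab; split; first exact: le_trans ab.
  move=> c; apply: le_trans (fx c) _; rewrite ler_wpM2r // ler_pM2l //.
  by rewrite ler_sqr // nnegrE (le_trans a0).
- move=> a b x y [a0 fx] [b0 fy]; split; first exact: addr_ge0.
  move=> c.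
  have rt t : 0 <= t -> 0 <= Num.sqrt (s * \sum_l c l ^+ 2) * t /\
     s * t ^+ 2 * (\sum_l c l ^+ 2) = (Num.sqrt (s * \sum_l c l ^+ 2) * t) ^+ 2.
    move=> t0; split; first by rewrite mulr_ge0 // sqrtr_ge0.
    rewrite exprMn sqr_sqrtr ?mulr_ge0 ?(ltW s_gt0) //; ring.
  have [r1 e1] := rt a a0; have [r2 e2] := rt b b0.
  have [_ e3] := rt (a + b) (addr_ge0 a0 b0).
  rewrite e3 mulrDr.
  have := sum_sqrD_le r1 r2; rewrite -e1 -e2 => /(_ _ _ _ (fx c) (fy c)).
  congr (_ <= _); apply: eq_bigr => i _; congr (_ ^+ 2).
  by rewrite -big_split /=; apply: eq_bigr => l _; rewrite mulrDr.
- move=> a t x [a0 fx]; split; first by rewrite mulr_ge0.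
  move=> c; rewrite exprMn real_normK ?num_real //.
  have := ler_wpM2l (sqr_ge0 t) (fx c); congr (_ <= _); last by ring.
  rewrite mulr_sumr; apply: eq_bigr => i _; rewrite -exprMn mulr_sumr.
  by congr (_ ^+ 2); apply: eq_bigr => l _; rewrite mulrCA.
- pose K : R := #|I'|%:R * #|L|%:R / s + 1.
  have K1 : 1 <= K by rewrite lerDr divr_ge0 ?mulr_ge0 // ltW.
  exists K; first by lra.
  move=> h u h0 uh; split; first by rewrite mulr_ge0 //; lra.
  move=> c /=.
  have le1 i : (\sum_l c l * u (p i, l)) ^+ 2 <= (\sum_l c l ^+ 2) * (#|L|%:R * h ^+ 2).
    apply: le_trans (sqr_sum_le _ _) _; rewrite ler_wpM2l //.
    apply: le_trans (ler_sum _ (G := fun=> h ^+ 2) _) _; last first.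
      by rewrite sumr_const mulr_natl.
    move=> l _; rewrite -[u _ ^+ 2]real_normK ?num_real // ler_sqr ?nnegrE //.
  apply: le_trans (ler_sum _ (fun i _ => le1 i)) _.
  have sum_cst (x : R) : \sum_(i : I') x = #|I'|%:R * x.
    by rewrite sumr_const mulr_natl.
  rewrite sum_cst.
  have -> : #|I'|%:R * ((\sum_l c l ^+ 2) * (#|L|%:R * h ^+ 2)) =
      #|I'|%:R * #|L|%:R * h ^+ 2 * \sum_l c l ^+ 2 by ring.
  apply: ler_wpM2r => //.
  rewrite exprMn [s * (_ * _)]mulrA; apply: ler_wpM2r; first exact: sqr_ge0.
  have : #|I'|%:R * #|L|%:R = s * (K - 1) by rewrite /K; field; lra.
  move=> ->; rewrite ler_pM2l //; apply: le_trans (_ : K * 1 <= _); first by lra.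
  by rewrite expr2 ler_pM2l //; lra.
- pose K : R := s + 1.
  exists K => [|a x [a0 fx] [i l]]; first by rewrite /K; lra.
  have [i' <-] := psurj i.
  rewrite -ler_sqr ?nnegrE ?mulr_ge0 // ?real_normK ?num_real //; last by rewrite /K; lra.
  have := fx (fun l' => (l' == l)%:R).
  have -> : \sum_(l0 : L) (l0 == l)%:R ^+ 2 = 1 :> R.
    rewrite (bigD1 l) //= eqxx expr1n big1 ?addr0 // => l' /negbTE ->.
    by rewrite expr0n.
  rewrite (bigD1 i') //=.
  have -> : \sum_l0 (l0 == l)%:R * x (p i', l0) = x (p i', l).
    rewrite (bigD1 l) //= eqxx mul1r big1 ?addr0 // => l' /negbTE ->.
    by rewrite mul0r.
  set S := \sum_(_ | _) _; have : 0 <= S by apply: sumr_ge0 => j _; exact: sqr_ge0.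
  rewrite mulr1 exprMn => S0 le.
  apply: (@le_trans _ _ (s * a ^+ 2)); first by lra.
  apply: ler_wpM2r; first exact: sqr_ge0.
  rewrite /K; nra.
Qed.

(** * Frames of low-rank tensors *)

(** [X (mix t i j)] is the entry of the matricization at [t] in row [i] and column [j], where both
    labels range over all of [idx n], so rows and columns are repeated. *)
Definition mix (d : nat) (n : 'I_d -> nat) (t : {set 'I_d}) (i j : idx n) : idx n :=
  [ffun k => if k \in t then i k else j k].

Lemma mixE (d : nat) (n : 'I_d -> nat) (t : {set 'I_d}) (i j : idx n) k :
  mix t i j k = if k \in t then i k else j k.
Proof. by rewrite ffunE. Qed.

Lemma idxP (d : nat) (n : 'I_d -> nat) (i j : idx n) :
  (forall k, i k = j k) -> i = j.
Proof. by move=> ij; apply/ffunP. Qed.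

Definition agree (d : nat) (n : 'I_d -> nat) (t : {set 'I_d}) (i j : idx n) : Prop :=
  forall k, k \in t -> i k = j k.

Definition local (d : nat) (n : 'I_d -> nat) (V : Type) (t : {set 'I_d})
    (f : idx n -> V) : Prop :=
  forall i j, agree t i j -> f i = f j.

Definition idx_card (R : realType) (d : nat) (n : 'I_d -> nat) : R :=
  #|{: idx n}|%:R.

Lemma idx_card_gt0 (R : realType) (d : nat) (n : 'I_d -> nat) :
  idx n -> 0 < idx_card R n.
Proof. by move=> i; rewrite ltr0n; apply/card_gt0P; exists i. Qed.

(* Fubini: in a sum over [idx n], disjoint groups of coordinates vary independently. *)
Lemma sum_disjoint (R : realType) (d : nat) (n : 'I_d -> nat) (t1 t2 : {set 'I_d})
    (F : idx n -> idx n -> R) :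
  [disjoint t1 & t2]%bool ->
  (forall j, local t1 (F^~ j)) -> (forall i, local t2 (F i)) ->
  idx_card R n * (\sum_i F i i) = \sum_i \sum_j F i j.
Proof.
move=> dis l1 l2; rewrite pair_bigA /=.
(* Exchanging the coordinates in [t1] turns [F p.1 p.2] into a diagonal value at one index and
   leaves the other index free; the free index yields the factor [idx_card R n]. *)
pose s (p : idx n * idx n) := (mix t1 p.1 p.2, mix t1 p.2 p.1).
have mixK (a b : idx n) : mix t1 (mix t1 a b) (mix t1 b a) = a.
  apply: idxP => k; rewrite mixE.
  by case: ifP => kt; rewrite mixE kt.
have sK : involutive s by move=> [i j]; rewrite /s /= !mixK.
have FE p : F p.1 p.2 = F (s p).1 (s p).1.
  rewrite (l1 _ (s p).1 p.1) => [|k kt]; last by rewrite mixE kt.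
  apply: l2 => k kt; rewrite mixE ifF //.
  by apply/negbTE; rewrite (disjointFl dis).
rewrite [RHS](eq_bigr _ (fun p _ => FE p)).
transitivity (\sum_(p : idx n * idx n) F p.1 p.1); last by rewrite (reindex_inj (inv_inj sK)).
rewrite -(pair_bigA _ (fun i (_ : idx n) => F i i)) /=.
under [RHS]eq_bigr do rewrite sumr_const.
by rewrite mulr_natl -sumrMnl.
Qed.

(** A matrix and its transpose have the same operator norm: pair [f] with the image of [b], apply
    Cauchy-Schwarz and divide by [S]. *)
Lemma frame_adjoint (R : realType) (I L : finType) (s : R) (U : I * L -> R)
    (f : I -> R) :
  0 < s -> frame s U ->
  \sum_l (\sum_i U (i, l) * f i) ^+ 2 <= s * \sum_i f i ^+ 2.
Proof.
move=> s0 fU; pose b l := \sum_i U (i, l) * f i; rewrite -/(b _).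
set S := \sum_l _; set F := \sum_i _.
have F0 : 0 <= F by apply: sumr_ge0 => i _; exact: sqr_ge0.
have S0 : 0 <= S by apply: sumr_ge0 => i _; exact: sqr_ge0.
have SE : S = \sum_i f i * \sum_l b l * U (i, l).
  under [RHS]eq_bigr do rewrite mulr_sumr.
  rewrite exchange_big /=; apply: eq_bigr => l _.
  rewrite expr2 -/(b l) {2}/b mulr_sumr; apply: eq_bigr => i _; ring.
have : S ^+ 2 <= F * (s * S).
  rewrite {1}SE; apply: le_trans (sqr_sum_le _ _) _.
  by rewrite ler_wpM2l.
have [->|Sn0] := eqVneq S 0; first by rewrite mulr_ge0 // ltW.
have Sp : 0 < S by rewrite lt_neqAle eq_sym Sn0.
by rewrite expr2 mulrA ler_pM2r // mulrC.
Qed.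

(** For frames that depend on disjoint groups of coordinates, this product at a common index is the
    Kronecker product. *)
Definition tensor (R : realType) (I L1 L2 : finType) (U1 : I * L1 -> R)
    (U2 : I * L2 -> R) : I * (L1 * L2) -> R :=
  fun il => U1 (il.1, il.2.1) * U2 (il.1, il.2.2).

Definition compress (R : realType) (I L L' : finType) (U : I * L -> R)
    (B : L * L' -> R) : I * L' -> R :=
  fun il => \sum_l U (il.1, l) * B (l, il.2).

Definition local_cols (R : realType) (d : nat) (n : 'I_d -> nat) (L : finType)
    (t : {set 'I_d}) (U : idx n * L -> R) : Prop :=
  forall l, local t (fun i => U (i, l)).

(** [sum_disjoint] decouples the two row indices, after which the two bounds apply in turn. The
    weight survives because decoupling costs one factor [idx_card R n] while the two frames
    contribute two. *)
Lemma frame_tensor (R : realType) (d : nat) (n : 'I_d -> nat) (L1 L2 : finType)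
    (t1 t2 : {set 'I_d}) (U1 : idx n * L1 -> R) (U2 : idx n * L2 -> R) :
  idx n -> [disjoint t1 & t2]%bool -> local_cols t1 U1 -> local_cols t2 U2 ->
  frame (idx_card R n) U1 -> frame (idx_card R n) U2 ->
  frame (idx_card R n) (tensor U1 U2).
Proof.
move=> i0 dis l1 l2 f1 f2 c; have N0 := idx_card_gt0 R i0.
rewrite -(ler_pM2l N0).
pose G i j := \sum_(l2 : L2) (\sum_(l1 : L1) c (l1, l2) * U1 (i, l1)) * U2 (j, l2).
have -> : \sum_i (\sum_l c l * tensor U1 U2 (i, l)) ^+ 2 = \sum_i G i i ^+ 2.
  apply: eq_bigr => i _; congr (_ ^+ 2); rewrite /G /tensor /=.
  under [RHS]eq_bigr do rewrite mulr_suml.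
  rewrite exchange_big pair_bigA /=; apply: eq_bigr => -[a b] _ /=; ring.
rewrite (sum_disjoint (t1 := t1) (t2 := t2) (F := fun i j => G i j ^+ 2)) //.
- apply: le_trans (ler_sum _ (fun i _ => f2 _)) _.
  rewrite -mulr_sumr ler_pM2l // exchange_big /=.
  apply: le_trans (ler_sum _ (fun i _ => f1 _)) _.
  by rewrite -mulr_sumr ler_pM2l // exchange_big pair_bigA /=;
    apply: ler_sum => -[a b] _.
- move=> j i i' ii'; congr (_ ^+ 2); apply: eq_bigr => b _; congr (_ * _).
  by apply: eq_bigr => a _; congr (_ * _); exact: l1.
- by move=> i j j' jj'; congr (_ ^+ 2); apply: eq_bigr => b _; congr (_ * _); exact: l2.
Qed.

Lemma local_tensor (R : realType) (d : nat) (n : 'I_d -> nat) (L1 L2 : finType)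
    (t1 t2 : {set 'I_d}) (U1 : idx n * L1 -> R) (U2 : idx n * L2 -> R) :
  local_cols t1 U1 -> local_cols t2 U2 -> local_cols (t1 :|: t2)%SET (tensor U1 U2).
Proof.
move=> l1 l2 [a b] i j ij; rewrite /tensor /=; congr (_ * _).
  by apply: l1 => k kt; apply: ij; rewrite finset.inE kt.
by apply: l2 => k kt; apply: ij; rewrite finset.inE kt orbT.
Qed.

Lemma frame_compress (R : realType) (I L L' : finType) (s : R) (U : I * L -> R)
    (B : L * L' -> R) :
  0 <= s -> frame s U -> frame 1 B -> frame s (compress U B).
Proof.
move=> s0 fU fB c.
have -> : \sum_i (\sum_l c l * compress U B (i, l)) ^+ 2 =
    \sum_i (\sum_l (\sum_l' c l' * B (l, l')) * U (i, l)) ^+ 2.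
  apply: eq_bigr => i _; congr (_ ^+ 2); rewrite /compress /=.
  under eq_bigr do rewrite mulr_sumr.
  under [RHS]eq_bigr do rewrite mulr_suml.
  rewrite exchange_big; apply: eq_bigr => l _; apply: eq_bigr => l' _; ring.
apply: le_trans (fU _) _; rewrite ler_wpM2l //.
by apply: le_trans (fB _) _; rewrite mul1r.
Qed.

Lemma local_compress (R : realType) (d : nat) (n : 'I_d -> nat) (L L' : finType)
    (t : {set 'I_d}) (U : idx n * L -> R) (B : L * L' -> R) :
  local_cols t U -> local_cols t (compress U B).
Proof.
by move=> lU a i j ij; apply: eq_bigr => l _; congr (_ * _); exact: lU.
Qed.

(* The orthogonal projection onto the span of [U], acting on the coordinates
   in [t], fixes [Z]. *)
Definition fixes (R : realType) (d : nat) (n : 'I_d -> nat) (L : finType)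
    (t : {set 'I_d}) (U : idx n * L -> R) (Z : idx n -> R) : Prop :=
  forall i, idx_card R n * Z i =
    \sum_j \sum_l U (i, l) * U (j, l) * Z (mix t j i).

(** Applying one projection after the other gives a double sum over [j] and [j']; since these act on
    disjoint coordinates, [sum_disjoint] folds it into the projection of the tensor frame. *)
Lemma fixes_tensor (R : realType) (d : nat) (n : 'I_d -> nat) (L1 L2 : finType)
    (t1 t2 : {set 'I_d}) (U1 : idx n * L1 -> R) (U2 : idx n * L2 -> R)
    (Z : idx n -> R) :
  [disjoint t1 & t2]%bool -> local_cols t1 U1 -> local_cols t2 U2 ->
  fixes t1 U1 Z -> fixes t2 U2 Z -> fixes (t1 :|: t2)%SET (tensor U1 U2) Z.
Proof.
move=> dis l1 l2 p1 p2 i; have N0 := idx_card_gt0 R i.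
apply: (mulfI (lt0r_neq0 N0)).
pose F j j' := \sum_(l1 : L1) \sum_(l2 : L2) U1 (i, l1) * U1 (j, l1) *
  (U2 (i, l2) * U2 (j', l2) * Z (mix t2 j' (mix t1 j i))).
have t1F k : k \in t2 -> (k \in t1) = false by move=> kt; rewrite (disjointFl dis).
have t2F k : k \in t1 -> (k \in t2) = false by move=> kt; rewrite (disjointFr dis).
transitivity (\sum_j \sum_j' F j j').
  rewrite p1 mulr_sumr; apply: eq_bigr => j _.
  rewrite mulr_sumr exchange_big /=; apply: eq_bigr => a _.
  rewrite mulrCA p2 mulr_sumr; apply: eq_bigr => j' _.
  rewrite mulr_sumr; apply: eq_bigr => b _; congr (_ * (_ * _ * _)).
  by apply: l2 => k kt; rewrite mixE t1F.
rewrite -(sum_disjoint (t1 := t1) (t2 := t2)) //.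
- congr (_ * _); apply: eq_bigr => j _; rewrite /F pair_bigA /=.
  apply: eq_bigr => -[a b] _ /=; rewrite /tensor /=.
  have -> : mix (t1 :|: t2)%SET j i = mix t2 j (mix t1 j i).
    by apply: idxP => k; rewrite !mixE finset.inE; case: (k \in t1); case: (k \in t2).
  ring.
- move=> j' j1 j2 jj; apply: eq_bigr => a _; apply: eq_bigr => b _.
  congr (_ * _ * (_ * Z _)); first exact: l1.
  by apply: idxP => k; rewrite !mixE; case: ifP => //; case: ifP => // /jj.
- move=> j j1 j2 jj; apply: eq_bigr => a _; apply: eq_bigr => b _.
  congr (_ * (_ * _ * Z _)); first exact: l2.
  by apply: idxP => k; rewrite !mixE; case: ifP => // /jj.
Qed.

(** The witness is the coefficient matrix of [Z], the transpose of [U] times [Z] over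
    [idx_card R n]. It is a contraction because [frame_adjoint] and the bound on [Z] each give one
    factor [idx_card R n], and the two cancel the squared normalization. *)
Lemma fixes_compress (R : realType) (d : nat) (n : 'I_d -> nat) (L L' : finType)
    (t : {set 'I_d}) (U : idx n * L -> R) (Z : idx n * L' -> R) :
  idx n -> frame (idx_card R n) U -> frame (idx_card R n) Z -> local_cols t Z ->
  (forall a, fixes t U (fun i => Z (i, a))) ->
  exists B : L * L' -> R, frame 1 B /\ Z = compress U B.
Proof.
move=> i0 fU fZ lZ pZ; have N0 := idx_card_gt0 R i0.
have Nn0 := lt0r_neq0 N0.
exists (fun la => (idx_card R n)^-1 * \sum_j U (j, la.1) * Z (j, la.2)); split.
  move=> c; rewrite mul1r.
  pose f j := \sum_a c a * Z (j, a).
  have -> : \sum_l (\sum_a c a * ((idx_card R n)^-1 * \sum_j U (j, l) * Z (j, a))) ^+ 2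
     = (idx_card R n)^-1 ^+ 2 * \sum_l (\sum_j U (j, l) * f j) ^+ 2.
    rewrite mulr_sumr; apply: eq_bigr => l _; rewrite -exprMn; congr (_ ^+ 2).
    rewrite /f; under [X in _ = _ * X]eq_bigr do rewrite mulr_sumr.
    rewrite exchange_big mulr_sumr /=; apply: eq_bigr => a _.
    rewrite mulrCA; congr (_ * _); rewrite mulr_sumr; apply: eq_bigr => j _; ring.
  rewrite exprVn mulrC ler_pdivrMr ?exprn_gt0 //.
  apply: le_trans (frame_adjoint f N0 fU) _.
  by rewrite mulrC expr2 mulrA ler_pM2r // mulrC fZ.
apply/funext => -[i a]; rewrite /compress /=.
apply: (mulfI Nn0); rewrite pZ exchange_big mulr_sumr /=; apply: eq_bigr => l _.
rewrite mulrCA [idx_card _ _ * (_ * _)]mulrA mulfV // mul1r mulr_sumr; apply: eq_bigr => j _.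
rewrite mulrA; congr (_ * _); apply: lZ => k kt; rewrite mixE kt //.
Qed.

(** Gram-Schmidt by deflation: normalize a nonzero column of [M], project it away, and recurse on a
    matrix of smaller rank. When the rank falls short of [r], the remaining columns of [U] are zero,
    hence the inequality in place of orthonormality. [W] records that the columns of [U] are
    combinations of those of [M]. *)
Lemma orthonormal_basis (R : realType) (p q r : nat) (M : 'M[R]_(p, q)) :
  (\rank M <= r)%N ->
  exists (U : 'M[R]_(p, r)) (W : 'M[R]_(q, r)),
    [/\ U = M *m W, U *m U^T *m M = M &
      forall c : 'cV[R]_r, ((U *m c)^T *m (U *m c)) 0 0 <= (c^T *m c) 0 0].
Proof.
elim: r M => [|r IHr] M rM.
  exists 0, 0; split; first by rewrite mulmx0.
    by move: rM; rewrite leqn0 mxrank_eq0 => /eqP ->; rewrite mulmx0.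
  move=> c; rewrite mul0mx mulmx0 mxE [leRHS]mxE.
  by apply: sumr_ge0 => i _; rewrite mxE -expr2 sqr_ge0.
have [->|M0] := eqVneq M 0.
  exists 0, 0; split; rewrite ?mulmx0 // => c.
  rewrite mul0mx mulmx0 mxE [leRHS]mxE.
  by apply: sumr_ge0 => i _; rewrite mxE -expr2 sqr_ge0.
have [[i0 j0] Mij] : exists ij, M ij.1 ij.2 != 0.
  apply: contrapT => nz; case/eqP: M0; apply/matrixP => i j; rewrite mxE.
  by apply: contrapT => /eqP Mij; apply: nz; exists (i, j).
pose m : 'cV[R]_p := M *m delta_mx j0 0.
have mE i : m i 0 = M i j0.
  rewrite mxE (bigD1 j0) //= big1 ?mxE ?eqxx ?mulr1 ?addr0 // => j /negbTE jj.
  by rewrite mxE jj mulr0.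
pose s := \sum_i m i 0 ^+ 2.
have s0 : 0 < s.
  rewrite /s (bigD1 i0) //= ltr_wpDr ?sumr_ge0 // => [i _|]; first exact: sqr_ge0.
  by rewrite mE lt_neqAle sqr_ge0 andbT eq_sym sqrf_eq0.
pose e : 'cV[R]_q := (Num.sqrt s)^-1 *: delta_mx j0 0.
have [u ue] : exists u, u = M *m e by exists (M *m e).
have uE : u = (Num.sqrt s)^-1 *: m by rewrite ue -scalemxAr.
have uu : u^T *m u = 1%:M.
  apply/matrixP => a b; rewrite !ord1 mxE [RHS]mxE eqxx uE.
  have -> : \sum_j ((Num.sqrt s)^-1 *: m)^T 0 j * ((Num.sqrt s)^-1 *: m) j 0 = s^-1 * s.
    transitivity (s^-1 * \sum_i m i 0 ^+ 2) => //; rewrite mulr_sumr; apply: eq_bigr => i _.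
    by rewrite !mxE -/(Num.sqrt s) mulrACA -expr2 exprVn sqr_sqrtr ?ltW // -expr2.
  by rewrite mulVf ?gt_eqF.
pose K : 'M[R]_p := 1%:M - u *m u^T.
have KT : K^T = K by rewrite /K linearB /= trmx1 trmx_mul trmxK.
have uK : u^T *m K = 0.
  by rewrite /K mulmxBr mulmx1 mulmxA uu mul1mx subrr.
(* [K] annihilates [u], which lies in the column space of [M], so the rank drops by at least one.
   The count is done on transposes, where [u^T] lies in the row space of [M^T] and in the kernel of
   [K]. *)
have rM' : (\rank (K *m M) <= r)%N.
  rewrite -mxrank_tr trmx_mul KT -ltnS.
  apply: leq_trans rM; rewrite -[leqRHS]mxrank_tr -(mxrank_mul_ker M^T K) -addn1 leq_add2l.
  have uin : (u^T <= M^T :&: kermx K)%MS.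
    rewrite sub_capmx; apply/andP; split; last by apply/sub_kermxP.
    by rewrite ue trmx_mul submxMl.
  apply: leq_trans (mxrankS uin); rewrite lt0n mxrank_eq0.
  apply: contra_eq_neq uu => ->; rewrite mul0mx eq_sym.
  by apply/eqP => /matrixP/(_ 0 0); rewrite !mxE eqxx => /eqP; rewrite oner_eq0.
have [U' [W' [UE pU cU]]] := IHr _ rM'.
have uU : u^T *m U' = 0 by rewrite UE !mulmxA uK !mul0mx.
have Uu : U'^T *m u = 0 by rewrite -[u]trmxK -trmx_mul uU trmx0.
have KM : K *m M = M - u *m u^T *m M by rewrite mulmxBl mul1mx.
suff : exists (U : 'M[R]_(p, 1 + r)) (W : 'M[R]_(q, 1 + r)),
    [/\ U = M *m W, U *m U^T *m M = M &
      forall c : 'cV[R]_(1 + r), ((U *m c)^T *m (U *m c)) 0 0 <= (c^T *m c) 0 0].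
  by [].
(* The second block unfolds [K *m M *m W'] as [M] times a matrix, using [u = M *m e]. *)
exists (row_mx u U'), (row_mx e ((1%:M - e *m u^T *m M) *m W')); split.
- rewrite mul_mx_row -ue; congr row_mx.
  by rewrite UE KM mulmxA mulmxBr mulmx1 ue !mulmxA.
- rewrite tr_row_mx mul_row_col mulmxDl.
  have -> : U' *m U'^T *m M = K *m M.
    rewrite -[RHS]pU KM mulmxBr -!mulmxA [U'^T *m (u *m _)]mulmxA Uu mul0mx mulmx0.
    by rewrite subr0.
  by rewrite KM addrC subrK.
- move=> c; rewrite -[c]vsubmxK; move: (usubmx c) (dsubmx c) => c0 c1.
  rewrite mul_row_col tr_col_mx mul_row_col.
  have trD (A B : 'cV[R]_p) : (A + B)^T = A^T + B^T by exact: linearD.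
  rewrite trD mulmxDl !mulmxDr !trmx_mul.
  have -> : c0^T *m u^T *m (u *m c0) = c0^T *m c0.
    by rewrite mulmxA -[c0^T *m u^T *m u]mulmxA uu mulmx1.
  have -> : c0^T *m u^T *m (U' *m c1) = 0.
    by rewrite mulmxA -[c0^T *m u^T *m U']mulmxA uU mulmx0 mul0mx.
  have -> : c1^T *m U'^T *m (u *m c0) = 0.
    by rewrite mulmxA -[c1^T *m U'^T *m u]mulmxA Uu mulmx0 mul0mx.
  have addE (A B : 'M[R]_1) : (A + B) 0 0 = A 0 0 + B 0 0 by rewrite mxE.
  rewrite addr0 add0r -trmx_mul !addE lerD2l; exact: cU.
Qed.

Lemma merge_mix (d : nat) (n : 'I_d -> nat) (t : {set 'I_d}) (i j : idx n) :
  Defs.merge [ffun s : {k : 'I_d | k \in t} => i (sval s)]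
        [ffun s : {k : 'I_d | k \notin t} => j (sval s)] = mix t i j.
Proof.
apply: idxP => k; rewrite mixE ffunE.
set rr := finfun _; set cc := finfun _.
have gen (b : bool) (e : (k \in t) = b) :
  (if b as b0 return ((k \in t) = b0 -> 'I_(n k))
   then fun h => rr (exist (fun k => k \in t) k h)
   else fun h => cc (exist (fun k => k \notin t) k (negbT h))) e =
  if b then i k else j k.
  by case: b e => e; rewrite /rr /cc ffunE.
exact: gen.
Qed.

(** The column span of the matricization of [X] at [t]. *)
Definition in_span (R : realType) (d : nat) (n : 'I_d -> nat) (t : {set 'I_d})
    (X Z : idx n -> R) : Prop :=
  exists w : idx n -> R, forall i, Z i = \sum_j X (mix t i j) * w j.

Lemma local_in_span (R : realType) (d : nat) (n : 'I_d -> nat) (t : {set 'I_d})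
    (X Z : idx n -> R) : in_span t X Z -> local t Z.
Proof.
move=> [w ZE] i j ij; rewrite !ZE; apply: eq_bigr => l _; congr (X _ * _).
by apply: idxP => k; rewrite !mixE; case: ifP => // /ij.
Qed.

Lemma in_spanT (R : realType) (d : nat) (n : 'I_d -> nat) (X : idx n -> R) :
  idx n -> in_span [set: 'I_d]%SET X X.
Proof.
move=> i0; exists (fun j => (j == i0)%:R) => i.
rewrite (bigD1 i0) //= eqxx mulr1 big1 ?addr0 => [|j /negbTE ->]; last by rewrite mulr0.
by congr X; apply: idxP => k; rewrite mixE finset.inE.
Qed.

(** The last clause is the nestedness behind hierarchical projections: a column of the matricization
    at a larger node [t'] is a slice of [X], so its own fibres along [t] are columns at [t] and are
    fixed. The basis is scaled by the square root of [idx_card R n] to meet the weight of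
    [frame]. *)
Lemma mrank_frame (R : realType) (d : nat) (n : 'I_d -> nat) (t : {set 'I_d})
    (X : idx n -> R) (r : nat) :
  idx n -> (mrank t X <= r)%N ->
  exists U : idx n * 'I_r -> R,
    [/\ frame (idx_card R n) U, (forall l, in_span t X (fun i => U (i, l))) &
      forall (t' : {set 'I_d}) Z, t \subset t' -> in_span t' X Z -> fixes t U Z].
Proof.
move=> i0 rX; have N0 := idx_card_gt0 R i0.
(* The matricization with repeated rows and columns; it factors through a rank factorization of the
   original, so its rank is no larger. *)
pose M : 'M[R]_(#|{: idx n}|, #|{: idx n}|) :=
  \matrix_(i, j) X (mix t (enum_val i) (enum_val j)).
have rM : (\rank M <= r)%N.
  apply: leq_trans rX; rewrite /mrank; set A := matricization t X.
  pose rr (i : idx n) : rowIdx n t := [ffun s : {k | k \in t} => i (sval s)].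
  pose cc (i : idx n) : colIdx n t := [ffun s : {k | k \notin t} => i (sval s)].
  pose L : 'M[R]_(_, \rank A) :=
    \matrix_(i < #|{: idx n}|, a < \rank A) col_base A (enum_rank (rr (enum_val i))) a.
  pose C : 'M[R]_(\rank A, _) :=
    \matrix_(a < \rank A, j < #|{: idx n}|) row_base A a (enum_rank (cc (enum_val j))).
  have -> : M = L *m C; last exact: mulmx_max_rank.
  apply/matrixP => i j.
  have := congr1 (fun B : 'M[R]_(_, _) =>
    B (enum_rank (rr (enum_val i))) (enum_rank (cc (enum_val j)))) (mulmx_base A).
  have -> : A (enum_rank (rr (enum_val i))) (enum_rank (cc (enum_val j))) = M i j.
    by rewrite !mxE !enum_rankK merge_mix.
  rewrite mxE => <-; rewrite mxE.
  by apply: eq_bigr => a _; rewrite !mxE.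
have [U [W [UE pU cU]]] := orthonormal_basis rM.
have ME i j : M (enum_rank i) (enum_rank j) = X (mix t i j).
  by rewrite mxE !enum_rankK.
pose s := Num.sqrt (idx_card R n).
have ss : s * s = idx_card R n by rewrite -expr2 sqr_sqrtr ?ltW.
have XE i k : idx_card R n * X (mix t i k) =
    \sum_j \sum_l (s * U (enum_rank i) l) * (s * U (enum_rank j) l) * X (mix t j k).
  have := congr1 (fun B : 'M[R]_(_, _) => B (enum_rank i) (enum_rank k)) pU.
  rewrite ME => <-.
  rewrite mxE mulr_sumr (reindex (@enum_rank (idx n))) /=; last first.
    by exists enum_val => j _; rewrite ?enum_rankK ?enum_valK.
  apply: eq_bigr => j _; rewrite mxE ME mulr_suml mulr_sumr.
  apply: eq_bigr => l _; rewrite mxE -ss; ring.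
exists (fun il => s * U (enum_rank il.1) il.2); split.
- move=> c /=; have := cU (\col_l c l).
  rewrite mxE [leRHS]mxE => le.
  have -> : \sum_l c l ^+ 2 = \sum_j (\col_l c l)^T 0 j * (\col_l c l) j 0.
    by apply: eq_bigr => l _; rewrite !mxE expr2.
  apply: (@le_trans _ _ (idx_card R n *
      \sum_j (U *m \col_l c l)^T 0 j * (U *m \col_l c l) j 0)); last first.
    by rewrite ler_pM2l.
  rewrite mulr_sumr [leRHS](reindex (@enum_rank (idx n))) /=; last first.
    by exists enum_val => j _; rewrite ?enum_rankK ?enum_valK.
  rewrite le_eqVlt; apply/orP; left; apply/eqP; apply: eq_bigr => i _.
  rewrite mxE -expr2 -ss -expr2 -exprMn; congr (_ ^+ 2).
  rewrite mxE mulr_sumr; apply: eq_bigr => l _; rewrite !mxE; ring.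
- move=> l; exists (fun j => s * W (enum_rank j) l) => i /=.
  rewrite UE mxE mulr_sumr (reindex (@enum_rank (idx n))) /=; last first.
    by exists enum_val => j _; rewrite ?enum_rankK ?enum_valK.
  apply: eq_bigr => j _; rewrite ME; ring.
- move=> t' Z tt' [w ZE] i; rewrite ZE.
  have mixtt j l : mix t j (mix t' i l) = mix t' (mix t j i) l.
    apply: idxP => k; rewrite !mixE; have := fintype.subsetP tt' k.
    by case: (k \in t) => // ->.
  have mixid l : mix t i (mix t' i l) = mix t' i l.
    apply: idxP => k; rewrite !mixE; have := fintype.subsetP tt' k.
    by case: (k \in t) => // ->.
  rewrite mulr_sumr.
  under eq_bigr => l _ do rewrite -mixid mulrA XE mulr_suml.
  rewrite exchange_big; apply: eq_bigr => j _ /=.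
  under eq_bigr => l _ do rewrite mulr_suml.
  rewrite exchange_big; apply: eq_bigr => a _ /=.
  by rewrite ZE mulr_sumr; apply: eq_bigr => l _; rewrite mixtt [RHS]mulrA.
Qed.

(** * Quantization of frames *)

(** A functional on functions of [J] is pushed forward to [J'] by summing its weights over the
    fibres of [p]. *)
Lemma quantizable_reindex (R : realType) (J J' : finType) (p : J -> J')
    (F : set (J' -> R)) (e : R) (N : nat) :
  quantizable F e N -> quantizable [set x | exists2 y, F y & x = y \o p] e N.
Proof.
move=> [I [q cI qP]].
pose G : set (J -> R) := [set x | exists2 y, F y & x = y \o p].
have ch x : exists y, G x -> F y /\ x = y \o p.
  have [[y Fy xy]|nG] := pselect (G x); first by exists y.
  by exists (fun=> 0).
pose s x := projT1 (cid (ch x)).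
have sP x : G x -> F (s x) /\ x = s x \o p by rewrite /s; case: cid.
exists I; exists (q \o s) => // x y Gx Gy /= qxy w b wb.
pose w' j' := \sum_(j | p j == j') w j.
have dE f : dotp w (f \o p) = dotp w' f.
  rewrite /dotp (partition_big p xpredT) //=; apply: eq_bigr => j' _.
  by rewrite mulr_suml; apply: eq_bigr => j /eqP <-.
have [Fx xE] := sP x Gx; have [Fy yE] := sP y Gy.
have -> : dotp w x = dotp w' (s x) by rewrite -dE -xE.
have -> : dotp w y = dotp w' (s y) by rewrite -dE -yE.
by apply: qP => // f Ff; rewrite -dE; apply: wb; exists f.
Qed.

Lemma quantizable_frames (R : realType) (L L' : finType) (e : R) (K : nat) :
  0 < e <= 1 -> 14 <= K%:R * e ->
  quantizable [set B : L * L' -> R | frame 1 B] e (K ^ (#|L| * #|L'|)).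
Proof.
move=> e01 Ke; rewrite -card_prod.
have <- : frame_pull (L := L') (id : L -> L) 1 1 = [set B : L * L' -> R | frame 1 B].
  rewrite /frame_pull mul1r expr1n; apply/seteqP.
  have BE (B : L * L' -> R) : (fun il => B (il.1, il.2)) = B by apply/funext => -[].
  by split=> B /=; rewrite BE // => -[].
by apply: quantizable_ball => //; apply: relnorm_frame_pull => // i; exists i.
Qed.

Definition local_frames (R : realType) (d : nat) (n : 'I_d -> nat) (L : finType)
    (t : {set 'I_d}) : set (idx n * L -> R) :=
  [set U | local_cols t U /\ frame (idx_card R n) U].

(** A frame local to mode [k] is the pullback of a function on ['I_(n k) * L], so the exponent
    involves [n k] and not the size of [idx n]. The map [up] varies coordinate [k] of a base index
    and serves as a section. *)
Lemma quantizable_leaf (R : realType) (d : nat) (n : 'I_d -> nat) (L : finType)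
    (k : 'I_d) (e : R) (K : nat) :
  idx n -> 0 < e <= 1 -> 14 <= K%:R * e ->
  quantizable (local_frames [set k]%SET : set (idx n * L -> R)) e (K ^ (n k * #|L|)).
Proof.
move=> i0 e01 Ke; have N0 := idx_card_gt0 R i0.
pose up (x : 'I_(n k)) : idx n := [ffun k' => dfwith (fun k => i0 k) k x k'].
have upk x : up x k = x by rewrite ffunE dfwithin.
have := quantizable_ball (@relnorm_frame_pull R _ _ L (fun i : idx n => i k)
  _ N0 (fun x => ex_intro _ (up x) (upk x))) e01 Ke.
move=> /(quantizable_reindex (fun il : idx n * L => (il.1 k, il.2))).
rewrite card_prod card_ord; congr (quantizable _ _ _).
apply/seteqP; split=> [U [V [_ fV] UE]|U [lU fU]].
  split; last by rewrite expr1n mulr1 in fV; rewrite UE.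
  move=> l i j ij; rewrite UE /= (ij k) // finset.inE.
  by [].
exists (fun xl => U (up xl.1, xl.2)).
  split=> //; rewrite expr1n mulr1.
  move: fU; congr (frame _ _); apply/funext => -[i l] /=.
  by apply: lU => k' /set1P ->; rewrite upk.
apply/funext => -[i l] /=; apply: lU => k' /set1P ->; by rewrite upk.
Qed.

Lemma sum_pair (R : realType) (I J : finType) (F : I * J -> R) :
  \sum_p F p = \sum_i \sum_j F (i, j).
Proof. by rewrite pair_bigA; apply: eq_bigr => -[]. Qed.

Lemma quantizable_tensor (R : realType) (I L1 L2 : finType)
    (F1 : set (I * L1 -> R)) (F2 : set (I * L2 -> R)) (e1 e2 : R) (N1 N2 : nat) :
  quantizable F1 e1 N1 -> quantizable F2 e2 N2 ->
  quantizable [set Z | exists x y, [/\ F1 x, F2 y & Z = tensor x y]] (e1 + e2) (N1 * N2).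
Proof.
apply: quantizable_bilinear => [w y|w x].
  exists (fun il => \sum_l2 w (il.1, (il.2, l2)) * y (il.1, l2)) => x.
  rewrite /dotp !sum_pair; apply: eq_bigr => i _.
  rewrite sum_pair; apply: eq_bigr => l1 _; rewrite mulr_suml.
  by apply: eq_bigr => l2 _; rewrite /tensor /=; ring.
exists (fun il => \sum_l1 w (il.1, (l1, il.2)) * x (il.1, l1)) => y.
rewrite /dotp !sum_pair; apply: eq_bigr => i _.
rewrite sum_pair exchange_big; apply: eq_bigr => l1 _ /=; rewrite mulr_suml.
by apply: eq_bigr => l2 _; rewrite /tensor /=; ring.
Qed.

Lemma quantizable_compress (R : realType) (I L L' : finType)
    (F1 : set (I * L -> R)) (F2 : set (L * L' -> R)) (e1 e2 : R) (N1 N2 : nat) :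
  quantizable F1 e1 N1 -> quantizable F2 e2 N2 ->
  quantizable [set Z | exists x y, [/\ F1 x, F2 y & Z = compress x y]] (e1 + e2) (N1 * N2).
Proof.
apply: quantizable_bilinear => [w y|w x].
  exists (fun il => \sum_a w (il.1, a) * y (il.2, a)) => x.
  rewrite /dotp !sum_pair; apply: eq_bigr => i _; rewrite /compress /=.
  under eq_bigr do rewrite mulr_sumr.
  under [RHS]eq_bigr do rewrite mulr_suml.
  rewrite exchange_big; apply: eq_bigr => l _; apply: eq_bigr => a _ /=; ring.
exists (fun la => \sum_i w (i, la.2) * x (i, la.1)) => y.
rewrite /dotp !sum_pair /compress /=.
under eq_bigr => i _ do (under eq_bigr do rewrite mulr_sumr; rewrite exchange_big /=).
rewrite exchange_big /=; apply: eq_bigr => l _.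
under [RHS]eq_bigr do rewrite mulr_suml.
rewrite exchange_big; apply: eq_bigr => a _; apply: eq_bigr => i _ /=; ring.
Qed.

(** * Dimension trees and tensor formats *)

(** Common ground of the HT trees and the TT node family, so that one induction serves both. *)
Definition splitting (d : nat) (T : {set {set 'I_d}}) : Prop :=
  finset.set0 \notin T /\
  forall t, t \in T -> (1 < #|t|)%N ->
    exists t1 t2, [/\ t1 \in T, t2 \in T, [disjoint t1 & t2]%bool & (t1 :|: t2 = t)%SET].

Lemma splitting_dim_tree (d : nat) (T : {set {set 'I_d}}) :
  is_dim_tree T -> splitting T.
Proof.
case=> _ _ n0 _ sp; split=> // t tT t1; exact: sp.
Qed.

Lemma splitting_TT (d : nat) : splitting (format_nodes (TT d)).
Proof.
split=> [|t] /=.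
  rewrite finset.inE negb_or; apply/andP; split; apply/negP.
    by move=> /imsetP[i _ /setP/(_ i)]; rewrite !finset.inE leqnn.
  by move=> /imsetP[i _ /setP/(_ i)]; rewrite !finset.inE eqxx.
rewrite finset.inE => /orP[/imsetP[i _ ->]|/imsetP[i _ ->]]; last by rewrite cards1.
move=> c1.
have id : (i.+1 < d)%N.
  rewrite ltn_neqAle ltn_ord andbT; apply/negP => /eqP id; move: c1.
  suff -> : [set j : 'I_d | (i <= j)%N]%SET = [set i]%SET by rewrite cards1.
  apply/setP => j; rewrite !finset.inE -val_eqE /=; have := ltn_ord j; lia.
exists [set i]%SET, [set j : 'I_d | (Ordinal id <= j)%N]%SET; split.
- by rewrite finset.inE; apply/orP; right; apply/imsetP; exists i.
- by rewrite finset.inE; apply/orP; left; apply/imsetP; exists (Ordinal id).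
- by rewrite disjoints1 finset.inE /= ltnn.
- apply/setP => j; rewrite !finset.inE -val_eqE /=; lia.
Qed.

Lemma card_setU_disjoint (T : finType) (t1 t2 : {set T}) :
  [disjoint t1 & t2]%bool -> #|(t1 :|: t2)%SET| = (#|t1| + #|t2|)%N.
Proof. by rewrite -finset.leq_card_setU => /eqP. Qed.

Lemma sum_setU_disjoint (T : finType) (t1 t2 : {set T}) (F : T -> nat) :
  [disjoint t1 & t2]%bool ->
  (\sum_(k in (t1 :|: t2)%SET) F k = \sum_(k in t1) F k + \sum_(k in t2) F k)%N.
Proof.
by move=> dis; rewrite -bigU //; apply: eq_bigl => k; rewrite !finset.inE.
Qed.

(** Induction on the size of the node. A frame at [t] is the tensor product of frames at the sons
    followed by a transfer matrix. A binary tree with [#|t|] leaves has [2 * #|t| - 1] nodes, hence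
    the precision; each leaf contributes [n k * r] parameters and each of the [#|t| - 1] interior
    nodes at most [r ^ 3]. The column type [L] is free because sons use ['I_r] while the root has a
    single column, the tensor itself. *)
Lemma tree_frames (R : realType) (d : nat) (n : 'I_d -> nat)
    (T : {set {set 'I_d}}) (r K : nat) (e : R) :
  idx n -> splitting T -> (0 < r)%N -> (0 < K)%N -> 0 < e <= 1 -> 14 <= K%:R * e ->
  forall t, t \in T -> forall L : finType, (#|L| <= r)%N ->
  exists F : set (idx n * L -> R),
    [/\ (F `<=` local_frames t)%classic,
        quantizable F (e *+ (2 * #|t|).-1)
          (K ^ ((\sum_(k in t) n k) * r + (#|t| - 1) * r ^ 3)) &
        forall X, (forall s, s \in T -> (mrank s X <= r)%N) ->
        forall U, frame (idx_card R n) U -> (forall l, in_span t X (fun i => U (i, l))) ->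
        F U].
Proof.
move=> i0 [T0 spT] r0 K0 e01 Ke t; have [m] := ubnP #|t|.
elim: m t => // m IHm t tm tT L Lr.
have N0 := idx_card_gt0 R i0.
have t0 : (0 < #|t|)%N.
  by rewrite finset.card_gt0; apply: contraNneq T0 => <-.
have [t1|t1] := leqP #|t| 1.
  have /cards1P[k tk] : #|t| == 1 by rewrite eqn_leq t1.
  exists (local_frames t); split=> //.
    rewrite tk; apply: quantizable_le (quantizable_leaf L k i0 e01 Ke) _ _.
      by rewrite cards1 muln1.
    by rewrite big_set1 leq_pexp2l // cards1 subnn mul0n addn0 leq_mul.
  move=> X _ U fU sU; split=> // l; exact: local_in_span (sU l).
have [s1 [s2 [s1T s2T dis st]]] := spT t tT t1.
have ct : #|t| = (#|s1| + #|s2|)%N by rewrite -st card_setU_disjoint.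
have s10 : (0 < #|s1|)%N by rewrite finset.card_gt0; apply: contraNneq T0 => <-.
have s20 : (0 < #|s2|)%N by rewrite finset.card_gt0; apply: contraNneq T0 => <-.
have cr : (#|'I_r| <= r)%N by rewrite card_ord.
have [F1 [lf1 q1 m1]] := IHm s1 ltac:(lia) s1T 'I_r cr.
have [F2 [lf2 q2 m2]] := IHm s2 ltac:(lia) s2T 'I_r cr.
have q := quantizable_compress (quantizable_tensor q1 q2)
  (quantizable_frames ('I_r * 'I_r)%type L e01 Ke).
move: q; match goal with |- quantizable ?G _ _ -> _ => move=> q; exists G end.
split; last 1 first.
- move=> X Xr U fU sU.
  have [V1 [fV1 sV1 pV1]] := mrank_frame i0 (Xr _ s1T).
  have [V2 [fV2 sV2 pV2]] := mrank_frame i0 (Xr _ s2T).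
  have lV1 : local_cols s1 V1 by move=> l; exact: local_in_span (sV1 l).
  have lV2 : local_cols s2 V2 by move=> l; exact: local_in_span (sV2 l).
  have lU : local_cols t U by move=> l; exact: local_in_span (sU l).
  have [B [fB UB]] : exists B, frame 1 B /\ U = compress (tensor V1 V2) B.
    apply: (fixes_compress (t := t) i0 (frame_tensor i0 dis lV1 lV2 fV1 fV2) fU lU) => a.
    rewrite -{1}st; apply: fixes_tensor => //.
      by apply: (pV1 t) (sU a); rewrite -st finset.subsetUl.
    by apply: (pV2 t) (sU a); rewrite -st finset.subsetUr.
  exists (tensor V1 V2), B; split=> //.
  by exists V1, V2; split=> //; [apply: m1 (Xr) _ _ _|apply: m2 (Xr) _ _ _].
- move=> _ [_ [B [[V1 [V2 [/lf1[l1 f1] /lf2[l2 f2] ->]]] fB ->]]]; split.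
    by apply: local_compress; rewrite -st; exact: local_tensor.
  apply: (frame_compress (ltW N0) _ fB).
  exact: (frame_tensor i0 dis l1 l2 f1 f2).
- apply: quantizable_le q _ _.
    rewrite -mulrnDr -mulrSr ct le_eqVlt; apply/orP; left; apply/eqP.
    by congr (e *+ _); lia.
  rewrite -!expnD leq_pexp2l //.
  have -> : (\sum_(k in t) n k = \sum_(k in s1) n k + \sum_(k in s2) n k)%N.
    by rewrite -st sum_setU_disjoint.
  rewrite card_prod card_ord ct.
  have : (r * r * #|L| <= r ^ 3)%N by rewrite !expnS expn0 muln1 mulnA leq_mul2l Lr orbT.
  have -> : (#|s1| + #|s2| - 1 = (#|s1| - 1) + (#|s2| - 1) + 1)%N by lia.
  nia.
Qed.

(** The modes up to [m] are tensored one by one with no compression in between, so the column type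
    grows to [r ^ m.+1]; at the last mode this is the format of the HOSVD core. *)
Lemma mode_frames (R : realType) (d : nat) (n : 'I_d -> nat) (r K : nat) (e : R) :
  idx n -> 0 < e <= 1 -> 14 <= K%:R * e ->
  forall m, (m < d)%N ->
  exists (L : finType) (F : set (idx n * L -> R)),
    let t := [set k : 'I_d | (k <= m)%N]%SET in
    [/\ #|L| = (r ^ m.+1)%N, (F `<=` local_frames t)%classic,
        quantizable F (e *+ m.+1) (K ^ ((\sum_(k in t) n k) * r)) &
        forall X, (forall k, (mrank [set k]%SET X <= r)%N) ->
        exists U, F U /\ fixes t U X].
Proof.
move=> i0 e01 Ke.
have leaf k X : (mrank [set k]%SET X <= r)%N ->
    exists U : idx n * 'I_r -> R, local_frames [set k]%SET U /\ fixes [set k]%SET U X.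
  move=> rX; have [U [fU sU pU]] := mrank_frame i0 rX; exists U; split.
    by split=> // l; exact: local_in_span (sU l).
  apply: (pU [set: 'I_d]%SET); first by rewrite finset.subsetT.
  exact: in_spanT.
elim=> [|m IHm] md.
  pose k := Ordinal md.
  have -> : [set k : 'I_d | (k <= 0)%N]%SET = [set k]%SET.
    by apply/setP => j; rewrite !finset.inE -val_eqE /= leqn0.
  exists 'I_r, (local_frames [set k]%SET); split=> //.
  - by rewrite card_ord expn1.
  - by rewrite big_set1; have := quantizable_leaf 'I_r k i0 e01 Ke; rewrite card_ord.
  - by move=> X rX; have [U ?] := leaf k X (rX k); exists U.
have [L [F [cL lF qF mF]]] := IHm (ltnW md).
pose k := Ordinal md; set t := [set j : 'I_d | (j <= m)%N]%SET in lF qF mF *.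
have tk : [set j : 'I_d | (j <= m.+1)%N]%SET = (t :|: [set k])%SET.
  by apply/setP => j; rewrite !finset.inE -val_eqE /=; lia.
have dis : [disjoint t & [set k]%SET]%bool.
  by rewrite disjoint_sym disjoints1 finset.inE /= ltnn.
have q := quantizable_tensor qF (quantizable_leaf 'I_r k i0 e01 Ke).
rewrite tk; exists (L * 'I_r)%type.
move: q; match goal with |- quantizable ?G _ _ -> _ => move=> q; exists G end.
split; last 1 first.
- move=> X rX; have [U1 [FU1 pU1]] := mF X rX; have [U2 [FU2 pU2]] := leaf k X (rX k).
  exists (tensor U1 U2); split; first by exists U1, U2.
  apply: fixes_tensor => //; first by case: (lF _ FU1).
  by case: FU2.
- by rewrite card_prod card_ord cL [in RHS]expnSr.
- move=> _ [U1 [U2 [/lF[l1 f1] [l2 f2] ->]]]; split; first exact: local_tensor.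
  exact: (frame_tensor i0 dis l1 l2 f1 f2).
- apply: quantizable_le q _ _; first by rewrite [in leRHS]mulrSr.
  by rewrite -expnD card_ord sum_setU_disjoint // big_set1 mulnDl.
Qed.

(** The parameter count of the format, equal to the natural number that [sample_bound] multiplies by
    a logarithm. *)
Definition format_dim (d : nat) (n : 'I_d -> nat) (f : tformat d)
    (r : {set 'I_d} -> nat) : nat :=
  let rr := rmax f r in let nn := nmax n in
  match f with
  | HOSVD => rr ^ d + d * nn * rr
  | _ => (d - 1) * rr ^ 3 + d * nn * rr
  end.

Lemma sum_dims_le (d : nat) (n : 'I_d -> nat) (t : {set 'I_d}) :
  (\sum_(k in t) n k <= d * nmax n)%N.
Proof.
apply: leq_trans (_ : \sum_(k in t) nmax n <= _)%N.
  by apply: leq_sum => k _; exact: (leq_bigmax k).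
by rewrite sum_nat_const leq_mul2r -[X in (_ <= X)%N]card_ord max_card orbT.
Qed.

Lemma frame_unit (R : realType) (I : finType) (s : R) (X : I -> R) :
  \sum_i X i ^+ 2 <= s <-> frame s (fun iu : I * unit => X iu.1).
Proof.
have E (c : unit -> R) : \sum_i (\sum_(l : unit) c l * X i) ^+ 2 =
    c tt ^+ 2 * \sum_i X i ^+ 2.
  by rewrite mulr_sumr; apply: eq_bigr => i _; rewrite (big_pred1 tt) ?exprMn // => -[].
have E' (c : unit -> R) : \sum_l c l ^+ 2 = c tt ^+ 2.
  by rewrite (big_pred1 tt) // => -[].
split=> [Xs c /=|/(_ (fun=> 1))]; rewrite E E'.
  by rewrite mulrC ler_wpM2r // sqr_ge0.
by rewrite expr1n mul1r mulr1.
Qed.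

(* A low-rank tensor is built from at most [2 * d] factors; each is quantized
   with precision [(8 * d)^-1], hence [112 = 14 * 8] and the total [4^-1]. *)
Lemma quantizable_low_rank (R : realType) (d : nat) (n : 'I_d -> nat)
    (f : tformat d) (r : {set 'I_d} -> nat) :
  idx n -> (2 <= d)%N -> valid_format f -> (0 < rmax f r)%N ->
  exists F : set (idx n * unit -> R),
    [/\ (forall U, F U -> \sum_i U (i, tt) ^+ 2 <= idx_card R n),
        quantizable F 4^-1 ((112 * d) ^ format_dim n f r) &
        forall X, low_rank f r X -> \sum_i X i ^+ 2 <= idx_card R n ->
          F (fun iu => X iu.1)].
Proof.
move=> i0 d2 vf r0; pose e : R := (8 * d%:R)^-1.
have dR : 2 <= d%:R :> R by rewrite ler_nat.
have de : d%:R * e = 8^-1 by rewrite /e; field; lra.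
have e0 : 0 < e by rewrite invr_gt0; lra.
have e01 : 0 < e <= 1 by rewrite e0 /= invf_le1; lra.
have Ke : 14 <= (112 * d)%:R * e.
  by rewrite natrM -mulrA de; lra.
have K0 : (0 < 112 * d)%N by lia.
move: (112 * d)%N K0 Ke => K K0 Ke.
have dd : d.-1.+1 = d by case: (d) d2.
have N0 := idx_card_gt0 R i0.
have lr (X : idx n -> R) : low_rank f r X ->
    forall t, t \in format_nodes f -> (mrank t X <= rmax f r)%N.
  by move=> lX t tf; apply: leq_trans (lX t tf) _; exact: leq_bigmax_cond.
have FU (t : {set 'I_d}) (F : set (idx n * unit -> R)) :
    (F `<=` local_frames t)%classic ->
    forall U, F U -> \sum_i U (i, tt) ^+ 2 <= idx_card R n.
  move=> FF U /FF[_ fU]; apply/frame_unit; move: fU; congr (frame _ _).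
  by apply/funext => -[i []].
have tree : splitting (format_nodes f) -> [set: 'I_d]%SET \in format_nodes f ->
    format_dim n f r = ((d - 1) * rmax f r ^ 3 + d * nmax n * rmax f r)%N ->
    exists F : set (idx n * unit -> R),
    [/\ (forall U, F U -> \sum_i U (i, tt) ^+ 2 <= idx_card R n),
        quantizable F 4^-1 (K ^ format_dim n f r) &
        forall X, low_rank f r X -> \sum_i X i ^+ 2 <= idx_card R n ->
          F (fun iu => X iu.1)].
  move=> sp fT ->.
  have u1 : (#|{: unit}| <= rmax f r)%N by rewrite card_unit.
  have [F [FF qF mF]] := tree_frames i0 sp r0 K0 e01 Ke fT u1.
  exists F; split; first exact: (FU _ _ FF).
    apply: quantizable_le qF _ _.
      rewrite -[e *+ _]mulr_natl cardsT card_ord.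
      apply: (@le_trans _ _ ((2 * d)%:R * e)); last by rewrite natrM -mulrA de; lra.
      by rewrite ler_pM2r // ler_nat leq_pred.
    rewrite leq_pexp2l // cardsT card_ord addnC leq_add2l leq_mul2r.
    by rewrite sum_dims_le orbT.
  move=> X lX sX; apply: (mF X (lr X lX)); first exact/frame_unit.
  by move=> l; exact: in_spanT.
case: f vf r0 lr tree => [_ r0 lr _|_ r0 lr tree|T vT r0 lr tree].
- have d1 : (d.-1 < d)%N by rewrite dd.
  have [L [F [cL FF qF mF]]] := mode_frames (rmax (HOSVD d) r) i0 e01 Ke d1.
  have tT : [set k : 'I_d | (k <= d.-1)%N]%SET = [set: 'I_d]%SET.
    by apply/setP => k; rewrite !finset.inE -ltnS dd ltn_ord.
  rewrite tT in FF qF mF.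
  have := quantizable_compress qF (quantizable_frames L unit e01 Ke).
  match goal with |- quantizable ?G _ _ -> _ => move=> q; exists G end; split.
  + apply: (FU [set: 'I_d]%SET) => _ [V [B [/FF[lV fV] fB ->]]].
    split; first exact: local_compress.
    exact: (frame_compress (ltW N0) fV fB).
  + apply: quantizable_le q _ _.
      (* There are [d] frames and one core, and [d + 1 <= 2 * d]. *)
      rewrite dd -mulrSr -[e *+ _]mulr_natl.
      apply: (@le_trans _ _ ((2 * d)%:R * e)); last by rewrite natrM -mulrA de; lra.
      by rewrite ler_pM2r // ler_nat; lia.
    rewrite -expnD leq_pexp2l // cL card_unit muln1 dd /= addnC leq_add2l.
    by rewrite leq_mul2r sum_dims_le orbT.
  + move=> X lX sX.
    have rX k : (mrank [set k]%SET X <= rmax (HOSVD d) r)%N.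
      by apply: lr => //; apply/imsetP; exists k.
    have [U [FU' pU]] := mF X rX.
    have [lU fU] := FF _ FU'.
    have [B [fB XB]] : exists B, frame 1 B /\
        (fun iu : idx n * unit => X iu.1) = compress U B.
      apply: (fixes_compress (t := [set: 'I_d]%SET) i0 fU) => //.
        exact/frame_unit.
      move=> l i j ij; congr X; apply: idxP => k; apply: ij; exact: finset.in_setT.
    by exists U, B.
- apply: tree => //; first exact: splitting_TT.
  rewrite /= finset.inE; apply/orP; left; apply/imsetP; exists (Ordinal (ltnW d2)) => //.
- by apply: tree => //; [exact: splitting_dim_tree|case: vT].
Qed.

(** * Independence and concentration *)

(** Indices pass from generators to generated sigma-algebras one at a time. With the other events
    fixed and [H] their intersection, the finite measures [P (D & H)] and [P H * P D] of [D] agree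
    on the pi-system [G j0], hence on what it generates; [setT] in [G j0] identifies [P H] with the
    product. *)
Lemma independent_sigma (R : realType) (dT : measure_display) (T : measurableType dT)
    (P : probability T R) (J : finType) (G : J -> set (set T)) :
  (forall j, setI_closed (G j)) -> (forall j, G j `<=` measurable) ->
  (forall j, G j setT) ->
  (forall E : J -> set T, (forall j, G j (E j)) ->
    P (\bigcap_(j in [set: J]) E j) = (\prod_j P (E j))%E) ->
  forall E : J -> set T, (forall j, <<s G j >> (E j)) ->
    P (\bigcap_(j in [set: J]) E j) = (\prod_j P (E j))%E.
Proof.
move=> GI Gm GT PG E sE.
have sGm j : <<s G j >> `<=` measurable.
  by apply: smallest_sub; [exact: sigma_algebra_measurable|exact: Gm].
have claim (s : seq J) : forall E : J -> set T,
    (forall j, if j \in s then <<s G j >> (E j) else G j (E j)) ->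
    P (\bigcap_(j in [set: J]) E j) = (\prod_j P (E j))%E.
  elim: s => [|j0 s IHs] {sE}E sE; first exact: PG.
  have mE j : measurable (E j).
    by have := sE j; case: ifP => _; [exact: sGm|exact: Gm].
  pose H := \bigcap_(j in [set j | j != j0]) E j.
  have mH : measurable H.
    by apply: fin_bigcap_measurable => //; exact: finite_finset.
  have [j0s|j0s] := boolP (j0 \in s).
    apply: IHs => j; have := sE j; rewrite inE.
    by case: eqP => [->|//]; rewrite j0s.
  pose E' D j := if j == j0 then D else E j.
  have capE D : \bigcap_(j in [set: J]) E' D j = D `&` H.
    apply/seteqP; split=> [w h|w [Dw Hw] j _].
      split; first by have := h j0 I; rewrite /E' eqxx.
      by move=> j /= jj; have := h j I; rewrite /E' (negbTE jj).
    by rewrite /E'; case: eqP => // /eqP jj; exact: Hw.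
  have prodE D : (\prod_j P (E' D j) = P D * \prod_(j | j != j0) P (E j))%E.
    rewrite (bigD1 j0) //= {1}/E' eqxx; congr (_ * _)%E.
    by apply: eq_bigr => j /negbTE jj; rewrite /E' jj.
  have E'0 : E' (E j0) = E.
    by apply/funext => j; rewrite /E'; case: eqP => // ->.
  have IHD D : G j0 D -> P (D `&` H) = (P D * \prod_(j | j != j0) P (E j))%E.
    move=> GD; rewrite -capE IHs ?prodE // => j; rewrite /E'.
    case: eqP => [->|/eqP jj]; first by rewrite (negbTE j0s).
    by have := sE j; rewrite inE (negbTE jj).
  have PH : P H = (\prod_(j | j != j0) P (E j))%E.
    by have := IHD setT (GT j0); rewrite setTI probability_setT mul1e.
  have p0 : 0 <= fine (P H) by exact: fine_ge0.
  have PHfin : P H = (fine (P H))%:E by rewrite fineK // fin_num_measure.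
  have mm D : <<s G j0 >> D -> mrestr P mH D = mscale (NngNum p0) P D.
    apply: (@g_sigma_algebra_measure_unique _ R T (G j0) (Gm j0) (fun=> setT)) => //.
    - by rewrite bigcup_const.
    - move=> A GA; change (P (A `&` H) = (fine (P H))%:E * P A)%E.
      by rewrite -PHfin IHD // PH muleC.
    - move=> _; change (P (setT `&` H) < +oo)%E; rewrite setTI.
      by apply: (le_lt_trans (probability_le1 P mH)); exact: ltry.
  have sE0 : <<s G j0 >> (E j0) by have := sE j0; rewrite inE eqxx.
  have mm0 : P (E j0 `&` H) = ((fine (P H))%:E * P (E j0))%E := mm _ sE0.
  by rewrite -E'0 capE prodE -PH mm0 -PHfin muleC.
apply: (claim (enum J)) => j; rewrite mem_enum; exact: sE.
Qed.

(** The generators are the cylinders over one row. They are independent because the entries are, and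
    the linear combination of a row is measurable for the sigma-algebra of its cylinders. *)
Lemma independent_rows (R : realType) (dT : measure_display) (T : measurableType dT)
    (P : probability T R) (J K : finType) (xi : J -> K -> T -> R) (u : K -> R) :
  (forall j k, measurable_fun setT (xi j k)) ->
  mutually_independent P (fun p : J * K => xi p.1 p.2) ->
  mutually_independent P (fun j w => \sum_k xi j k w * u k).
Proof.
move=> mxi ind.
pose cyl j (B : K -> set R) := \bigcap_(k in [set: K]) xi j k @^-1` B k.
pose G j := [set cyl j B | B in [set B : K -> set R | forall k, measurable (B k)]].
have mcyl j B : (forall k, measurable (B k)) -> measurable (cyl j B).
  move=> mB; apply: fin_bigcap_measurable => [|k _]; first exact: finite_finset.
  by rewrite -[X in measurable X]setTI; exact: mxi.
have indB (B : J -> K -> set R) : (forall j k, measurable (B j k)) ->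
    P (\bigcap_(j in [set: J]) cyl j (B j)) = (\prod_j \prod_k P (xi j k @^-1` B j k))%E.
  move=> mB; rewrite pair_bigA /= -(ind (fun p => B p.1 p.2)) //.
  congr (P _); apply/seteqP; split=> [w h [j k] _|w h j _ k _]; first exact: (h j I k I).
  exact: (h (j, k) I).
have Pcyl j B : (forall k, measurable (B k)) ->
    P (cyl j B) = (\prod_k P (xi j k @^-1` B k))%E.
  move=> mB; pose B' j' k := if j' == j then B k else setT.
  transitivity (P (\bigcap_(j in [set: J]) cyl j (B' j))).
    congr (P _); apply/seteqP; split=> [w h j' _ k _|w h].
      by rewrite /B'; case: eqP => // ->; exact: h.
    by have := h j I; rewrite /B' eqxx.
  rewrite indB; last by move=> j' k; rewrite /B'; case: ifP.
  rewrite (bigD1 j) //= [X in (_ * X)%E]big1 ?mule1 => [|j' /negbTE jj].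
    by apply: eq_bigr => k _; rewrite /B' eqxx.
  by rewrite big1 // => k _; rewrite /B' jj preimage_setT probability_setT.
move=> C mC.
apply: (independent_sigma (G := G)).
- move=> j _ _ [B mB <-] [B' mB' <-]; exists (fun k => B k `&` B' k).
    by move=> k; exact: measurableI.
  apply/seteqP; split=> [w h|w [h h'] k _].
    by split=> k _; have [] := h k I.
  by split; [exact: h|exact: h'].
- by move=> j _ [B mB <-]; exact: mcyl.
- move=> j; exists (fun=> setT) => //.
  by apply/seteqP; split=> // w _ k _.
- move=> E GE.
  have /choice[B BE] : forall j, exists B, (forall k, measurable (B k)) /\ cyl j B = E j.
    by move=> j; have [B mB BE] := GE j; exists B.
  have -> : E = fun j => cyl j (B j) by apply/funext => j; case: (BE j).
  rewrite indB; last by move=> j k; case: (BE j) => /(_ k).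
  by apply: eq_bigr => j _; rewrite Pcyl //; case: (BE j).
- move=> j.
  have mx k : measurable_fun setT (xi j k : g_sigma_algebraType (G j) -> R).
    move=> _ Y mY; rewrite setTI; apply: sub_sigma_algebra.
    exists (fun k' => if k' == k then Y else setT); first by move=> k'; case: ifP.
    apply/seteqP; split=> [w h|w Yw k' _]; first by have := h k I; rewrite eqxx.
    by case: eqP => // ->.
  have mY : measurable_fun setT
      (fun w : g_sigma_algebraType (G j) => \sum_k xi j k w * u k).
    by apply: measurable_sum => k; apply: measurable_funM => //; exact: measurable_cst.
  by have := mY measurableT _ (mC j); rewrite setTI.
Qed.

From mathcomp Require Import finmap.
Import HBSimple HBNNSimple.

Lemma integral_indic_preimage (R : realType) (dT : measure_display)
    (T : measurableType dT) (P : probability T R) (xi : T -> R) (B : set R) :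
  measurable_fun setT xi -> measurable B ->
  (\int[P]_w (\1_B (xi w))%:E = P (xi @^-1` B))%E.
Proof.
move=> mxi mB; have mpre : measurable (xi @^-1` B).
  by rewrite -[X in measurable X]setTI; exact: mxi.
have := integral_indic P measurableT mpre; rewrite setIT => <-.
by apply: eq_integral => w _; rewrite !indicE.
Qed.

(** The standard extension from indicators to simple functions and, by monotone convergence, to
    nonnegative measurable [f]. *)
Lemma integral_mul_of_indic (R : realType) (dT : measure_display) (T : measurableType dT)
    (P : probability T R) (xi g : T -> R) (f : R -> R) (k : R) :
  measurable_fun setT xi -> measurable_fun setT g -> measurable_fun setT f ->
  (forall w, 0 <= g w) -> (forall x, 0 <= f x) ->
  (forall B, measurable B ->
    \int[P]_w (\1_B (xi w) * g w)%:E = P (xi @^-1` B) * k%:E)%E ->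
  (\int[P]_w (f (xi w) * g w)%:E = (\int[P]_w (f (xi w))%:E) * k%:E)%E.
Proof.
move=> mxi mg mf g0 f0 HB.
have mpre B : measurable B -> measurable (xi @^-1` B).
  by move=> mB; rewrite -[X in measurable X]setTI; exact: mxi.
have meas_ind B : measurable B -> measurable_fun setT (fun w => \1_B (xi w) : R).
  move=> mB; apply: (measurableT_comp (measurable_indic _) mxi); exact: mB.
have mEf : measurable_fun setT (EFin \o f) by exact/measurable_EFinP.
pose F := nnsfun_approx (@measurableT _ _) mEf.
have mF m : measurable_fun setT (F m : R -> R) by [].
have Fnd x a b : (a <= b)%N -> F a x <= F b x.
  by move=> ab; have /lefP := nd_nnsfun_approx (@measurableT _ _) mEf ab; apply.
have Fcvg x : (F m x)%:E @[m --> \oo] --> (f x)%:E.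
  by apply: (cvg_nnsfun_approx (@measurableT _ _) mEf) => // y _; rewrite /= lee_fin.
have mct (h : T -> R) : measurable_fun setT h -> (forall w, 0 <= h w) ->
    (\int[P]_w (F m (xi w) * h w)%:E)%E @[m --> \oo] -->
    (\int[P]_w (f (xi w) * h w)%:E)%E.
  move=> mh h0.
  have := @cvg_monotone_convergence _ T R P setT measurableT
    (fun m w => (F m (xi w) * h w)%:E).
  rewrite (_ : (\int[P]_x limn _)%E = (\int[P]_w (f (xi w) * h w)%:E)%E); last first.
    apply: eq_integral => w _; apply/cvg_lim => //=.
    under eq_fun do rewrite EFinM.
    by rewrite EFinM; apply: cvgeZr.
  apply.
  - move=> m; apply/measurable_EFinP; apply: measurable_funM => //.
    exact: (measurableT_comp (mF m) mxi).
  - by move=> m w _; rewrite lee_fin mulr_ge0.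
  - by move=> w _ a b ab; rewrite lee_fin ler_wpM2r // Fnd.
have simple (N : nat) (y : 'I_N -> R) (B : 'I_N -> set R) (h : T -> R) (k' : R) :
    measurable_fun setT h -> (forall w, 0 <= h w) ->
    (forall i, 0 <= y i) -> (forall i, measurable (B i)) ->
    (forall i, \int[P]_w (\1_(B i) (xi w) * h w)%:E = P (xi @^-1` (B i)) * k'%:E)%E ->
    (\int[P]_w ((\sum_(i < N) y i * \1_(B i) (xi w)) * h w)%:E =
      (\sum_(i < N) (y i)%:E * P (xi @^-1` (B i))) * k'%:E)%E.
  move=> mh h0 y0 mB hB.
  transitivity (\int[P]_w \sum_(i < N) ((y i)%:E * (\1_(B i) (xi w) * h w)%:E))%E.
    apply: eq_integral => w _; rewrite mulr_suml -sumEFin; apply: eq_bigr => i _.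
    by rewrite -EFinM mulrA.
  rewrite ge0_integral_sum //; last 2 first.
  - move=> i; apply/measurable_EFinP; apply: measurable_funM => //.
    by apply: measurable_funM => //; exact: meas_ind.
  - by move=> i w _; rewrite lee_fin !mulr_ge0.
  rewrite ge0_sume_distrl => [|i _]; last by rewrite mule_ge0 // lee_fin.
  apply: eq_bigr => i _; rewrite ge0_integralZl_EFin ?hB ?muleA //.
    by move=> w _; rewrite lee_fin mulr_ge0.
  by apply/measurable_EFinP; apply: measurable_funM => //; exact: meas_ind.
have step m : (\int[P]_w (F m (xi w) * g w)%:E = (\int[P]_w (F m (xi w) * 1)%:E) * k%:E)%E.
  under eq_integral do rewrite fimfunEord.
  under [in RHS]eq_integral do rewrite fimfunEord.
  set s := fset_set _.
  have mpF y : measurable (F m @^-1` [set y]).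
    by rewrite -[X in measurable X]setTI; apply: mF.
  have s0 (i : 'I_(size (finmap.enum_fset s))) : 0 <= (finmap.enum_fset s)`_i.
    have : (finmap.enum_fset s)`_i \in s by exact: mem_nth.
    by rewrite {2}/s in_fset_set // => /set_mem[x _ <-].
  rewrite (simple _ _ _ _ k) //; last by move=> i; exact: HB.
  rewrite (simple _ _ _ (fun=> 1) 1) ?mule1 //.
  move=> i; rewrite mule1.
  under eq_integral do rewrite mulr1.
  by rewrite integral_indic_preimage.
have := mct g mg g0.
under eq_fun do rewrite step.
move=> /(cvg_unique (@ereal_hausdorff R)); apply.
under [X in (X * _)%E]eq_integral do rewrite -[f _]mulr1.
apply: cvgeZr => //; exact: mct.
Qed.

(** Induction on the set of factors that may differ from indicators. When all are indicators the
    claim is independence itself, and [integral_mul_of_indic] releases one factor at a time. *)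
Lemma independent_integral_prod (R : realType) (dT : measure_display)
    (T : measurableType dT) (P : probability T R) (J : finType)
    (xi : J -> T -> R) (f : J -> R -> R) :
  (forall j, measurable_fun setT (xi j)) -> mutually_independent P xi ->
  (forall j, measurable_fun setT (f j)) -> (forall j x, 0 <= f j x) ->
  (forall j, \int[P]_w (f j (xi j w))%:E < +oo)%E ->
  (\int[P]_w (\prod_j f j (xi j w))%:E = \prod_j \int[P]_w (f j (xi j w))%:E)%E.
Proof.
move=> mxi ind.
have mpre j B : measurable B -> measurable (xi j @^-1` B).
  by move=> mB; rewrite -[X in measurable X]setTI; exact: mxi.
have int_ind j B : measurable B ->
    (\int[P]_w (\1_B (xi j w))%:E = P (xi j @^-1` B))%E.
  exact: integral_indic_preimage.
suff claim (s : seq J) : forall f : J -> R -> R,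
    (forall j, j \notin s -> exists2 B : set R, measurable B & f j = \1_B) ->
    (forall j, measurable_fun setT (f j)) -> (forall j x, 0 <= f j x) ->
    (forall j, \int[P]_w (f j (xi j w))%:E < +oo)%E ->
    (\int[P]_w (\prod_j f j (xi j w))%:E = \prod_j \int[P]_w (f j (xi j w))%:E)%E.
  by move=> mf f0 fi; apply: (claim (enum J)) => // j; rewrite mem_enum.
elim: s => [|j0 s IHs] {}f fs mf f0 fi.
  have /choice[B BP] : forall j, exists B : set R, measurable B /\ f j = \1_B.
    by move=> j; have [//|B mB fB] := fs j; exists B.
  have fE : f = fun j => \1_(B j) by apply/funext => j; case: (BP j).
  have mB j : measurable (B j) by case: (BP j).
  rewrite {}fE in fs mf f0 fi *.
  under [RHS]eq_bigr do rewrite int_ind //.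
  rewrite -ind //; set E := \bigcap_(j in _) _.
  have mE : measurable E.
    apply: fin_bigcap_measurable => [|j _]; first exact: finite_finset.
    exact: mpre.
  have := integral_indic P measurableT mE; rewrite setIT => <-.
  apply: eq_integral => w _; congr (_%:E).
  rewrite indicE; have [/set_mem wB|wB] := boolP (w \in _).
    by rewrite big1 // => j _; rewrite indicE mem_set //; exact: wB.
  have [j jB] : exists j, xi j w \notin B j.
    apply: contrapT => nB; case/negP: wB; apply/mem_set => j _ /=.
    by apply: contrapT => jB; apply: nB; exists j; apply/negP => /set_mem.
  by rewrite (bigD1 j) //= indicE (negbTE jB) mul0r.
have [j0s|j0s] := boolP (j0 \in s).
  apply: IHs => // j js; apply: fs; rewrite inE negb_or js andbT.
  by apply: contraNneq js => ->.
(* Replacing factor [j0] by an indicator brings the product under the induction hypothesis, which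
   supplies exactly the assumption of [integral_mul_of_indic]. *)
pose f' B j := if j == j0 then \1_B else f j : R -> R.
have mf' B : measurable B -> forall j, measurable_fun setT (f' B j).
  by move=> mB j; rewrite /f'; case: ifP => // _; exact: measurable_indic.
have f'0 B j x : 0 <= f' B j x by rewrite /f'; case: ifP.
have f'j0 B : f' B j0 = \1_B by rewrite /f' eqxx.
have f'E B j : j != j0 -> f' B j = f j by rewrite /f' => /negbTE ->.
have f'i B : measurable B -> forall j, (\int[P]_w (f' B j (xi j w))%:E < +oo)%E.
  move=> mB j; rewrite /f'; case: ifP => // _; rewrite int_ind //.
  by apply: (le_lt_trans (probability_le1 P (mpre j B mB))); exact: ltry.
pose g w := \prod_(j | j != j0) f j (xi j w).
pose k := (\prod_(j | j != j0) \int[P]_w (f j (xi j w))%:E)%E.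
have kfin : k \is a fin_num.
  rewrite /k; elim/big_ind: _ => // [x y|j _]; first exact: fin_numM.
  by rewrite ge0_fin_numE //; apply: integral_ge0 => w _; rewrite lee_fin.
have split_prod B w : \prod_j f' B j (xi j w) = \1_B (xi j0 w) * g w.
  rewrite (bigD1 j0) //= f'j0; congr (_ * _).
  by apply: eq_bigr => j jj; rewrite f'E.
have IH B : measurable B ->
    (\int[P]_w (\1_B (xi j0 w) * g w)%:E = P (xi j0 @^-1` B) * (fine k)%:E)%E.
  move=> mB; under eq_integral do rewrite -split_prod.
  rewrite IHs; [|move=> j js|exact: mf'|exact: f'0|exact: f'i].
    rewrite (bigD1 j0) //= f'j0 int_ind // fineK //; congr (_ * _)%E.
    by apply: eq_bigr => j jj; rewrite f'E.
  have [->|jj] := eqVneq j j0; first by exists B; rewrite ?f'j0.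
  by rewrite f'E //; apply: fs; rewrite inE negb_or jj.
have mg : measurable_fun setT g.
  rewrite /g; under eq_fun do rewrite -big_filter.
  by apply: measurable_prod => j _; exact: (measurableT_comp (mf j) (mxi j)).
have g0 w : 0 <= g w by apply: prodr_ge0.
under eq_integral do rewrite (bigD1 j0) //=.
rewrite (integral_mul_of_indic (mxi j0) mg (mf j0) g0 (f0 j0) IH).
by rewrite [in RHS](bigD1 j0) //= fineK.
Qed.

(** * Means and second moments *)

(** Integrability travels with the value, so that linear combinations can be formed with no side
    conditions. *)
Definition mean (R : realType) (dT : measure_display) (T : measurableType dT)
    (P : probability T R) (f : T -> R) (a : R) : Prop :=
  P.-integrable setT (EFin \o f) /\ (\int[P]_w (f w)%:E = a%:E)%E.

Lemma mean_cst (R : realType) (dT : measure_display) (T : measurableType dT)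
    (P : probability T R) (a : R) : mean P (fun=> a) a.
Proof.
split; first exact: finite_measure_integrable_cst.
have -> : (\int[P]__ a%:E = a%:E * P setT)%E by exact: integral_cst.
by rewrite probability_setT mule1.
Qed.

Lemma meanD (R : realType) (dT : measure_display) (T : measurableType dT)
    (P : probability T R) (f g : T -> R) (a b : R) :
  mean P f a -> mean P g b -> mean P (fun w => f w + g w) (a + b).
Proof.
move=> [fi fa] [gi gb]; split; first exact: (integrableD measurableT fi gi).
by rewrite EFinD -fa -gb; exact: (integralD_EFin measurableT fi gi).
Qed.

Lemma meanZ (R : realType) (dT : measure_display) (T : measurableType dT)
    (P : probability T R) (f : T -> R) (a c : R) :
  mean P f a -> mean P (fun w => c * f w) (c * a).
Proof.
move=> [fi fa]; split; first exact: (integrableZl measurableT c fi).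
by rewrite EFinM -fa; exact: (integralZl measurableT fi c).
Qed.

Lemma mean_sum (R : realType) (dT : measure_display) (T : measurableType dT)
    (P : probability T R) (I : Type) (s : seq I) (f : I -> T -> R) (a : I -> R) :
  (forall i, mean P (f i) (a i)) ->
  mean P (fun w => \sum_(i <- s) f i w) (\sum_(i <- s) a i).
Proof.
move=> fa; elim: s => [|i s IHs].
  rewrite big_nil; under [X in mean _ X]eq_fun do rewrite big_nil.
  exact: mean_cst.
rewrite big_cons; under [X in mean _ X]eq_fun do rewrite big_cons.
exact: meanD.
Qed.

Lemma mean_ge0 (R : realType) (dT : measure_display) (T : measurableType dT)
    (P : probability T R) (f : T -> R) (a : R) :
  measurable_fun setT f -> (forall w, 0 <= f w) ->
  (\int[P]_w (f w)%:E = a%:E)%E -> mean P f a.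
Proof.
move=> mf f0 fa; split=> //; apply/integrableP; split; first exact/measurable_EFinP.
under eq_integral do rewrite /= ger0_norm //.
by rewrite fa ltry.
Qed.

Lemma independent_mean2 (R : realType) (dT : measure_display)
    (T : measurableType dT) (P : probability T R) (J : finType)
    (xi : J -> T -> R) (j k : J) (f g : R -> R) (a b : R) :
  (forall j, measurable_fun setT (xi j)) -> mutually_independent P xi -> j != k ->
  measurable_fun setT f -> measurable_fun setT g ->
  (forall x, 0 <= f x) -> (forall x, 0 <= g x) ->
  mean P (f \o xi j) a -> mean P (g \o xi k) b ->
  mean P (fun w => f (xi j w) * g (xi k w)) (a * b).
Proof.
move=> mxi ind jk mf mg f0 g0 [_ fa] [_ gb].
have kj : k != j by rewrite eq_sym.
apply: mean_ge0 => [|w|].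
- by apply: measurable_funM; apply: measurableT_comp.
- exact: mulr_ge0.
pose h i : R -> R := if i == j then f else if i == k then g else fun=> 1.
have hj : h j = f by rewrite /h eqxx.
have hk : h k = g by rewrite /h (negbTE kj) eqxx.
have h1 i : (i != j) && (i != k) -> h i = fun=> 1.
  by rewrite /h => /andP[/negbTE -> /negbTE ->].
have hP i : [/\ measurable_fun setT (h i), (forall x, 0 <= h i x) &
    (\int[P]_w (h i (xi i w))%:E < +oo)%E].
  have [->|ij] := eqVneq i j; first by rewrite hj; split=> //; rewrite fa ltry.
  have [->|ik] := eqVneq i k; first by rewrite hk; split=> //; rewrite gb ltry.
  by rewrite h1 ?ij //; split=> //; have [_ ->] := mean_cst P 1; rewrite ltry.
have := independent_integral_prod mxi ind
  (fun i => let: And3 m _ _ := hP i in m) (fun i => let: And3 _ p _ := hP i in p)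
  (fun i => let: And3 _ _ q := hP i in q).
rewrite (bigD1 j) //= (bigD1 k) //= hj hk fa gb.
rewrite [X in (_ * (_ * X))%E]big1 => [|i ijk]; last first.
  by rewrite h1 //; case: (mean_cst P 1).
rewrite mule1 EFinM => <-; apply: eq_integral => w _.
rewrite (bigD1 j) //= (bigD1 k) //= hj hk.
by rewrite big1 ?mulr1 // => i ijk; rewrite h1.
Qed.

Lemma mean_sqr_sum (R : realType) (dT : measure_display) (T : measurableType dT)
    (P : probability T R) (J : finType) (xi : J -> T -> R) (u : J -> R) :
  (forall j, measurable_fun setT (xi j)) -> mutually_independent P xi ->
  (forall j, \int[P]_w (xi j w)%:E = 0)%E ->
  (forall j, \int[P]_w ((xi j w) ^+ 2)%:E = 1)%E ->
  mean P (fun w => (\sum_j xi j w * u j) ^+ 2) (\sum_j u j ^+ 2).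
Proof.
move=> mxi ind m1 m2.
have M2 j : mean P (fun w => xi j w ^+ 2) 1.
  by apply: mean_ge0 => //; [exact: measurable_funX|move=> w; exact: sqr_ge0].
(* A vanishing integral does not include integrability; this comes from the second moment, through
   [|x| <= x ^ 2 + 1]. *)
have M1 j : mean P (xi j) 0.
  split=> //; have [i1 _] := meanD (M2 j) (mean_cst P 1).
  apply: (le_integrable measurableT _ _ i1); first exact/measurable_EFinP.
  move=> w _; rewrite /= lee_fin; set x := xi j w.
  rewrite [leRHS]ger0_norm ?addr_ge0 ?sqr_ge0 //.
  rewrite -(real_normK (num_real x)); have := sqr_ge0 (`|x| - 1); nra.
(* [4 x = 2 (g x - h x)] with [g], [h] nonnegative of mean 2 reduces signed
   products to nonnegative ones. *)
pose g (x : R) := (x + 1) ^+ 2; pose h (x : R) := x ^+ 2 + 1.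
have mg : measurable_fun setT g.
  by apply: measurable_funX; apply: measurable_funD => //; exact: measurable_cst.
have mh : measurable_fun setT h.
  by apply: measurable_funD => //; exact: measurable_funX.
have g0 x : 0 <= g x by exact: sqr_ge0.
have h0 x : 0 <= h x by rewrite addr_ge0 ?sqr_ge0.
have Mg j : mean P (g \o xi j) 2.
  have := meanD (M2 j) (meanD (meanZ 2 (M1 j)) (mean_cst P 1)).
  rewrite mulr0 add0r; congr (mean _ _ _); apply/funext => w /=; rewrite /g; ring.
have Mh j : mean P (h \o xi j) 2 by exact: meanD (M2 j) (mean_cst P 1).
have M12 j k : mean P (fun w => xi j w * xi k w) (j == k)%:R.
  have [<-|jk] := eqVneq j k; first exact: M2.
  have I2 f f' := @independent_mean2 R dT T P J xi j k f f' 2 2 mxi ind jk.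
  have := meanD (meanZ (4^-1) (meanD (I2 g g mg mg g0 g0 (Mg j) (Mg k))
                                     (I2 h h mh mh h0 h0 (Mh j) (Mh k))))
                (meanZ (- 4^-1) (meanD (I2 g h mg mh g0 h0 (Mg j) (Mh k))
                                     (I2 h g mh mg h0 g0 (Mh j) (Mg k)))).
  congr (mean _ _ _); last by rewrite /=; lra.
  by apply/funext => w; rewrite /g /h; field.
have := mean_sum (index_enum J) (fun j => mean_sum (index_enum J)
  (fun k => meanZ (u j * u k) (M12 j k))).
congr (mean _ _ _).
  apply/funext => w; rewrite expr2 mulr_suml; apply: eq_bigr => j _.
  rewrite mulr_sumr; apply: eq_bigr => k _; ring.
apply: eq_bigr => j _; rewrite (bigD1 j) //= eqxx mulr1 -expr2 big1 ?addr0 //.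
by move=> k; rewrite eq_sym => /negbTE ->; rewrite mulr0.
Qed.

(** * Exponential moments and Bernstein's inequality *)

Lemma subgaussian_sum (R : realType) (dT : measure_display) (T : measurableType dT)
    (P : probability T R) (J : finType) (xi : J -> T -> R) (u : J -> R) (L : R) :
  (forall j, measurable_fun setT (xi j)) -> mutually_independent P xi ->
  (forall j, subgaussian P L (xi j)) ->
  forall t : R, (\int[P]_w (expR (t * \sum_j xi j w * u j))%:E <=
    (expR (L ^+ 2 * (\sum_j u j ^+ 2) * t ^+ 2 / 2))%:E)%E.
Proof.
move=> mxi ind sub t.
pose f j (x : R) := expR (t * u j * x).
have mf j : measurable_fun setT (f j).
  by apply: measurableT_comp => //; apply: measurable_funM.
have f0 j x : 0 <= f j x by exact: expR_ge0.
have fi j : (\int[P]_w (f j (xi j w))%:E <=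
    (expR (L ^+ 2 * (t * u j) ^+ 2 / 2))%:E)%E by exact: sub.
under eq_integral => w _.
  have -> : expR (t * \sum_j xi j w * u j) = \prod_j f j (xi j w).
    rewrite -expR_sum mulr_sumr; congr expR; apply: eq_bigr => j _; ring.
  over.
rewrite independent_integral_prod //; last first.
  by move=> j; apply: le_lt_trans (fi j) _; exact: ltry.
have -> : L ^+ 2 * (\sum_j u j ^+ 2) * t ^+ 2 / 2 =
    \sum_j L ^+ 2 * (t * u j) ^+ 2 / 2.
  rewrite mulr_sumr !mulr_suml; apply: eq_bigr => j _; ring.
rewrite expR_sum -prodEFin.
suff /andP[] : (0 <= \prod_j \int[P]_w (f j (xi j w))%:E <=
    \prod_j (expR (L ^+ 2 * (t * u j) ^+ 2 / 2))%:E)%E by [].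
elim/big_ind2: _ => [|a b a' b' /andP[a0 ab] /andP[a'0 ab']|j _].
- by rewrite lee01 lexx.
- by rewrite mule_ge0 //= lee_pmul.
- by rewrite fi andbT; apply: integral_ge0 => w _; rewrite lee_fin.
Qed.

(* Gaussian linearization: [expR (a * y ^+ 2)] is the mean of
   [expR (Num.sqrt (2 * a) * x * y)] over a standard normal [x]. *)
Lemma integral_expR_sqr (R : realType) (dT : measure_display) (T : measurableType dT)
    (P : probability T R) (Y : T -> R) (v a : R) :
  measurable_fun setT Y -> 0 <= a -> 4 * a * v <= 1 ->
  (forall t, \int[P]_w (expR (t * Y w))%:E <= (expR (v * t ^+ 2 / 2))%:E)%E ->
  (\int[P]_w (expR (a * Y w ^+ 2))%:E <= 2%:E)%E.
Proof.
move=> mY a0 av mgf.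
pose s := Num.sqrt (2 * a).
have ss : s ^+ 2 = 2 * a by rewrite sqr_sqrtr ?mulr_ge0.
pose phi := @normal_pdf R 0 1.
have phiE m s0 x : s0 != 0 -> @normal_pdf R m s0 x =
    normal_peak s0 * expR (- (x - m) ^+ 2 / (s0 ^+ 2 *+ 2)).
  by move=> /normal_pdfE ->.
have phi0 x : 0 <= phi x by exact: normal_pdf_ge0.
have mphi : measurable_fun setT phi by exact: measurable_normal_pdf.
have shift y x : expR (s * x * y) * phi x = expR (a * y ^+ 2) * normal_pdf (s * y) 1 x.
  rewrite /phi !phiE ?oner_eq0 // mulrCA [RHS]mulrCA -!expRD; congr (_ * expR _).
  have -> : a = s ^+ 2 / 2 by rewrite ss; field.
  by rewrite expr1n; field.
have gauss y : (\int[lebesgue_measure]_x (expR (s * x * y) * phi x)%:E =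
    (expR (a * y ^+ 2))%:E)%E.
  under eq_integral do rewrite shift EFinM.
  rewrite ge0_integralZl_EFin ?expR_ge0 //.
  - by rewrite integral_normal_pdf mule1.
  - by move=> x _; rewrite lee_fin normal_pdf_ge0.
  - by apply/measurable_EFinP; exact: measurable_normal_pdf.
under eq_integral do rewrite -gauss.
pose F (p : T * R) := (expR (s * p.2 * Y p.1) * phi p.2)%:E.
have mF : measurable_fun setT F.
  apply/measurable_EFinP; apply: measurable_funM; last first.
    exact: (measurableT_comp mphi).
  apply: measurableT_comp => //; apply: measurable_funM.
    by apply: measurable_funM => //; exact: measurable_snd.
  by apply: (measurableT_comp mY); exact: measurable_fst.
have F0 p : (0 <= F p)%E by rewrite lee_fin mulr_ge0 ?expR_ge0.
have := @fubini_tonelli _ _ T (measurableTypeR R) R P (@lebesgue_measure R) F mF.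
rewrite /F /= => -> //.
have s2 : Num.sqrt 2 != 0 :> R by rewrite sqrtr_eq0 -ltNge.
(* After [mgf] the integrand decays like [expR (- x ^ 2 / 4)], a Gaussian of variance 2; [c] is the
   ratio of the two normalizing constants. *)
pose c : R := normal_peak 1 / normal_peak (Num.sqrt 2).
have cE : c = Num.sqrt 2.
  rewrite /c /normal_peak sqr_sqrtr // expr1n mul1r -[2 * pi *+ 2]mulrnAr sqrtrM //.
  rewrite invrK mulrCA mulVf ?mulr1 // gt_eqF // sqrtr_gt0.
  by rewrite mulrn_wgt0 // pi_gt0.
have c2 : 0 <= c <= 2.
  rewrite cE sqrtr_ge0 /= -ler_sqr ?nnegrE ?sqrtr_ge0 // sqr_sqrtr //; lra.
(* Since [s ^ 2 = 2 * a], [mgf] gives the exponent [a * v * x ^ 2], at most [x ^ 2 / 4], half of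
   what the standard normal density provides. *)
have inner x : (\int[P]_w (expR (s * x * Y w) * phi x)%:E <=
    c%:E * (normal_pdf 0 (Num.sqrt 2) x)%:E)%E.
  under eq_integral do rewrite mulrC EFinM.
  rewrite ge0_integralZl_EFin ?phi0 //; last first.
    apply/measurable_EFinP; apply: measurableT_comp => //.
    by apply: measurable_funM.
  apply: le_trans (lee_wpmul2l _ (mgf (s * x))) _; first by rewrite lee_fin.
  rewrite -!EFinM lee_fin /phi !phiE ?oner_eq0 //.
  rewrite [c * (_ * _)]mulrA /c divfK; last by rewrite gt_eqF // normal_peak_gt0.
  rewrite -[leLHS]mulrA -expRD; apply: ler_wpM2l; first exact: normal_peak_ge0.
  rewrite ler_expR exprMn ss expr1n sqr_sqrtr // !subr0.
  have := sqr_ge0 x; nra.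
apply: (@le_trans _ _
  (\int[@lebesgue_measure R]_x (c%:E * (normal_pdf 0 (Num.sqrt 2) x)%:E))%E).
  apply: ge0_le_integral => //.
  - by move=> x _; apply: integral_ge0 => w _; rewrite lee_fin mulr_ge0 ?expR_ge0.
  - exact: (@measurable_fun_fubini_tonelli_G _ _ T (measurableTypeR R) R P F mF F0).
  - apply/measurable_EFinP; apply: measurable_funM => //.
    exact: measurable_normal_pdf.
rewrite ge0_integralZl_EFin //; last 3 first.
- by move=> x _; rewrite lee_fin normal_pdf_ge0.
- by apply/measurable_EFinP; exact: measurable_normal_pdf.
- by case/andP: c2.
by rewrite integral_normal_pdf mule1 lee_fin; case/andP: c2.
Qed.

Lemma integral_ge0D (R : realType) (dT : measure_display) (T : measurableType dT)
    (P : probability T R) (f g : T -> R) :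
  measurable_fun setT f -> measurable_fun setT g ->
  (forall w, 0 <= f w) -> (forall w, 0 <= g w) ->
  (\int[P]_w (f w + g w)%:E = \int[P]_w (f w)%:E + \int[P]_w (g w)%:E)%E.
Proof.
move=> mf mg f0 g0; under eq_integral do rewrite EFinD.
apply: ge0_integralD => //; try exact/measurable_EFinP.
  by move=> w _; rewrite lee_fin.
by move=> w _; rewrite lee_fin.
Qed.

Lemma integral_ge0Z (R : realType) (dT : measure_display) (T : measurableType dT)
    (P : probability T R) (c : R) (f : T -> R) :
  measurable_fun setT f -> (forall w, 0 <= f w) -> 0 <= c ->
  (\int[P]_w (c * f w)%:E = c%:E * \int[P]_w (f w)%:E)%E.
Proof.
move=> mf f0 c0; under eq_integral do rewrite EFinM.
apply: ge0_integralZl_EFin => //; last exact/measurable_EFinP.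
by move=> w _; rewrite lee_fin.
Qed.

Lemma integral_ge0_le (R : realType) (dT : measure_display) (T : measurableType dT)
    (P : probability T R) (f g : T -> R) :
  measurable_fun setT f -> measurable_fun setT g ->
  (forall w, 0 <= f w) -> (forall w, f w <= g w) ->
  (\int[P]_w (f w)%:E <= \int[P]_w (g w)%:E)%E.
Proof.
move=> mf mg f0 fg; apply: ge0_le_integral => //; try exact/measurable_EFinP.
  by move=> w _; rewrite lee_fin.
by move=> w _; rewrite lee_fin.
Qed.

Lemma expR_le_quadratic (R : realType) (x : R) :
  expR x <= 1 + x + x ^+ 2 * expR `|x|.
Proof.
have e1 : expR x - 1 <= x * expR x.
  have : (1 - x) * expR x <= 1.
    have := expR_ge1Dx (- x); rewrite expRN -[_^-1]mul1r ler_pdivlMr ?expR_gt0 //; lra.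
  by rewrite mulrBl mul1r; lra.
have e2 := expR_ge1Dx x.
have [x0|x0] := leP 0 x.
  have : x * (expR x - 1) <= x * (x * expR x) by rewrite ler_wpM2l.
  by rewrite mulrA -expr2 (ger0_norm x0); lra.
have ge1 : 1 <= expR `|x| by rewrite -[leLHS]expR0 ler_expR.
have : 0 <= (- x) * (expR x - 1 - x) by apply: mulr_ge0; lra.
have : x ^+ 2 * 1 <= x ^+ 2 * expR `|x| by rewrite ler_wpM2l ?sqr_ge0.
lra.
Qed.

Lemma sqr_le_expR (R : realType) (x : R) : 0 <= x -> x ^+ 2 <= 2 * expR x.
Proof.
move=> x0; have := expR_ge1Dxn 1 x0.
have -> : (2`!)%:R = 2 :> R by [].
lra.
Qed.

(** In [expR_le_quadratic] the linear term integrates to zero, and the quadratic one is absorbed by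
    the exponential moment of [Y ^ 2]. The choice [a = (4 * v)^-1] is the largest that
    [integral_expR_sqr] admits. *)
Lemma mgf_sqr_centered (R : realType) (dT : measure_display) (T : measurableType dT)
    (P : probability T R) (Y : T -> R) (v l : R) :
  measurable_fun setT Y -> 1 <= v -> `|l| <= (8 * v)^-1 ->
  mean P (fun w => Y w ^+ 2) 1 ->
  (forall t, \int[P]_w (expR (t * Y w))%:E <= (expR (v * t ^+ 2 / 2))%:E)%E ->
  (\int[P]_w (expR (l * (Y w ^+ 2 - 1)))%:E <= (expR (512 * v ^+ 2 * l ^+ 2))%:E)%E.
Proof.
move=> mY v1 lv [_ m2] mgf.
have v0 : 0 < v by lra.
pose b := (8 * v)^-1.
have b0 : 0 < b by rewrite invr_gt0; lra.
have bv : b * v = 8^-1 by rewrite /b; field; lra.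
pose a := 2 * b.
have E2 : (\int[P]_w (expR (a * Y w ^+ 2))%:E <= 2%:E)%E.
  apply: integral_expR_sqr mgf => //; first by rewrite /a; lra.
  by rewrite /a; lra.
have ea2 : expR a <= 2.
  have a1 : a <= 4^-1 by rewrite /a; nra.
  have := expR_ge1Dx (- a); rewrite expRN => e1.
  have : (expR a)^-1 >= 2^-1 by lra.
  by rewrite lef_pV2 // ?posrE ?expR_gt0.
(* [z ^ 2 = 64 * v ^ 2 * (b * |z|) ^ 2] gives 64; one factor 2 comes from [sqr_le_expR] and another
   from [expR a <= 2]. The mean of the last exponential doubles 256 to 512. *)
pose C : R := 256 * v ^+ 2 * l ^+ 2.
have C0 : 0 <= C by rewrite /C -mulrA -exprMn mulr_ge0 ?sqr_ge0.
have ptw y : expR (l * (y ^+ 2 - 1)) <= 1 + l * (y ^+ 2 - 1) + C * expR (a * y ^+ 2).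
  set z := y ^+ 2 - 1.
  apply: le_trans (expR_le_quadratic _) _; rewrite lerD2l.
  have zy : `|z| <= y ^+ 2 + 1.
    by apply: le_trans (ler_normB _ _) _; rewrite normr1 ger0_norm ?sqr_ge0.
  have h1 : (b * `|z|) ^+ 2 <= 2 * expR (b * `|z|).
    by apply: sqr_le_expR; rewrite mulr_ge0 // ltW.
  have h2 : expR `|l * z| <= expR (b * `|z|).
    by rewrite ler_expR normrM ler_wpM2r.
  have h3 : expR (b * `|z|) * expR (b * `|z|) <= 2 * expR (a * y ^+ 2).
    rewrite -expRD; apply: (@le_trans _ _ (expR (a + a * y ^+ 2))).
      by rewrite ler_expR /a; have := ler_wpM2l (ltW b0) zy; lra.
    by rewrite expRD ler_wpM2r ?expR_ge0.
  have zb : z ^+ 2 = 64 * v ^+ 2 * (b * `|z|) ^+ 2.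
    rewrite exprMn real_normK ?num_real // mulrA -[X in _ = X * _]mulrA -exprMn.
    by rewrite [v * b]mulrC bv; field.
  rewrite exprMn zb.
  have g0 := expR_ge0 (b * `|z|).
  have : (b * `|z|) ^+ 2 * expR `|l * z| <= 2 * (2 * expR (a * y ^+ 2)).
    apply: le_trans (ler_pM _ _ h1 h2) _; rewrite ?sqr_ge0 ?expR_ge0 //.
    by rewrite -mulrA ler_pM2l.
  move=> /(ler_wpM2l (_ : 0 <= l ^+ 2 * (64 * v ^+ 2))) le.
  have -> : l ^+ 2 * (64 * v ^+ 2 * (b * `|z|) ^+ 2) * expR `|l * z| =
    l ^+ 2 * (64 * v ^+ 2) * ((b * `|z|) ^+ 2 * expR `|l * z|) by ring.
  apply: le_trans (le _) _; first by rewrite mulr_ge0 ?sqr_ge0 // mulr_ge0 ?sqr_ge0.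
  by rewrite /C le_eqVlt; apply/orP; left; apply/eqP; ring.
(* With [l = p - q] the negative part of the linear term moves to the left-hand side. All integrands
   are then nonnegative, as [p <= 1] ensures for the constant [1 - p + q]. *)
pose p := Num.max l 0; pose q := Num.max (- l) 0.
have p0 : 0 <= p by rewrite le_max lexx orbT.
have q0 : 0 <= q by rewrite le_max lexx orbT.
have pq : l = p - q.
  rewrite /p /q; have [l0|l0] := leP l 0; first by rewrite max_l ?oppr_ge0 //; lra.
  by rewrite max_r; lra.
have p1 : p <= 1.
  rewrite /p ge_max ler01 andbT; apply: le_trans (ler_norm _) _.
  by apply: le_trans lv _; rewrite -/b; nra.
have mY2 : measurable_fun setT (fun w => Y w ^+ 2) by exact: measurable_funX.
have mexp (f : T -> R) : measurable_fun setT f -> measurable_fun setT (fun w => expR (f w)).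
  by move=> mf; exact: measurableT_comp.
have mq : measurable_fun setT (fun w => q * Y w ^+ 2) by exact: measurable_funM.
have mp : measurable_fun setT (fun w => p * Y w ^+ 2) by exact: measurable_funM.
have me : measurable_fun setT (fun w => expR (l * (Y w ^+ 2 - 1))).
  by apply: mexp; apply: measurable_funM => //; exact: measurable_funB.
have ma : measurable_fun setT (fun w => expR (a * Y w ^+ 2)).
  by apply: mexp; exact: measurable_funM.
have mc : measurable_fun setT (fun w => C * expR (a * Y w ^+ 2)).
  exact: measurable_funM.
have q1 w : 0 <= q * Y w ^+ 2 by rewrite mulr_ge0 ?sqr_ge0.
have p1' w : 0 <= p * Y w ^+ 2 by rewrite mulr_ge0 ?sqr_ge0.
have e1 w : 0 <= expR (l * (Y w ^+ 2 - 1)) by exact: expR_ge0.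
have c1 w : 0 <= C * expR (a * Y w ^+ 2) by rewrite mulr_ge0 ?expR_ge0.
have iY c : 0 <= c -> (\int[P]_w (c * Y w ^+ 2)%:E = c%:E)%E.
  move=> c0; rewrite integral_ge0Z ?m2 ?mule1 // => w; exact: sqr_ge0.
have main : (\int[P]_w (expR (l * (Y w ^+ 2 - 1)))%:E + q%:E <=
    (1 + q + 2 * C)%:E)%E.
  rewrite -(iY q q0) -integral_ge0D //.
  apply: (@le_trans _ _ (\int[P]_w ((1 - p + q) +
      (p * Y w ^+ 2 + C * expR (a * Y w ^+ 2)))%:E)%E).
    apply: integral_ge0_le => [||w|w].
    - exact: measurable_funD.
    - by apply: measurable_funD => //; exact: measurable_funD.
    - exact: addr_ge0.
    - have := ptw (Y w); rewrite {2}pq; lra.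
  rewrite (@integral_ge0D _ _ _ P (fun=> 1 - p + q)) //; last 3 first.
  - exact: measurable_funD.
  - by move=> w; lra.
  - by move=> w; exact: addr_ge0.
  rewrite (@integral_ge0D _ _ _ P _ _ mp mc p1' c1) (iY p p0).
  have [_ ->] := mean_cst P (1 - p + q).
  have le2 : (\int[P]_w (C * expR (a * Y w ^+ 2))%:E <= (C * 2)%:E)%E.
    rewrite integral_ge0Z //.
    by rewrite [(C * 2)%:E]EFinM lee_wpmul2l // lee_fin.
  apply: le_trans (leeD2l _ (leeD2l _ le2)) _.
  by rewrite -!EFinD lee_fin; lra.
have fin : (\int[P]_w (expR (l * (Y w ^+ 2 - 1)))%:E <= (1 + 2 * C)%:E)%E.
  rewrite -(leeD2rE _ _ (_ : q%:E \is a fin_num)) //; apply: le_trans main _.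
  by rewrite -EFinD lee_fin; lra.
apply: le_trans fin _; rewrite lee_fin.
apply: le_trans (expR_ge1Dx _) _.
by rewrite ler_expR /C; lra.
Qed.

Lemma tail_le_expR (R : realType) (dT : measure_display) (T : measurableType dT)
    (P : probability T R) (S : T -> R) (a : R) :
  measurable_fun setT S ->
  (P [set w | (a <= S w)%R] <= (expR (- a))%:E * \int[P]_w (expR (S w))%:E)%E.
Proof.
move=> mS; set E := [set w | _].
have mE : measurable E.
  rewrite -[E]setTI; have -> : E = S @^-1` `[a, +oo[.
    by apply/seteqP; split=> w; rewrite /E /= in_itv /= andbT.
  exact: mS.
have mexp : measurable_fun setT (fun w => expR (S w)) by exact: measurableT_comp.
rewrite -integral_ge0Z ?expR_ge0 //.
have := integral_indic P measurableT mE; rewrite setIT => <-.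
apply: integral_ge0_le => // [|w].
- exact: measurable_funM.
rewrite indicE -expRD.
have [/set_mem wE|_] := boolP (w \in E); last exact: expR_ge0.
by rewrite -[leLHS]expR0 ler_expR; rewrite /E /= in wE; lra.
Qed.

Lemma independent_row (R : realType) (dT : measure_display) (T : measurableType dT)
    (P : probability T R) (J K : finType) (xi : J -> K -> T -> R) (j : J) :
  mutually_independent P (fun p : J * K => xi p.1 p.2) -> mutually_independent P (xi j).
Proof.
move=> ind B mB; pose B' (p : J * K) := if p.1 == j then B p.2 else setT.
transitivity (P (\bigcap_(p in [set: J * K]) xi p.1 p.2 @^-1` B' p)).
  congr (P _); apply/seteqP; split=> [w h [j' k] _|w h k _].
    by rewrite /B' /=; case: eqP => // ->; exact: h.
  by have := h (j, k) I; rewrite /B' /= eqxx.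
rewrite ind => [|p]; last by rewrite /B'; case: ifP.
rewrite -(pair_bigA _ (fun j' k => P (xi j' k @^-1` B' (j', k)))) /= (bigD1 j) //=.
rewrite [X in (_ * X)%E]big1 ?mule1 => [|j' /negbTE jj].
  by apply: eq_bigr => k _; rewrite /B' /= eqxx.
by rewrite big1 // => k _; rewrite /B' /= jj preimage_setT probability_setT.
Qed.

Lemma sum_sqr_centered_tail (R : realType) (dT : measure_display)
    (T : measurableType dT) (P : probability T R) (m : nat) (Y : 'I_m -> T -> R)
    (v t : R) :
  (forall i, measurable_fun setT (Y i)) -> mutually_independent P Y ->
  1 <= v -> 0 < t <= 1 -> (forall i, mean P (fun w => Y i w ^+ 2) 1) ->
  (forall i l, \int[P]_w (expR (l * Y i w))%:E <= (expR (v * l ^+ 2 / 2))%:E)%E ->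
  measurable [set w | m%:R * t <= `|\sum_i (Y i w ^+ 2 - 1)|] /\
  (P [set w | (m%:R * t <= `|\sum_i (Y i w ^+ 2 - 1)|)%R] <=
    (2 * expR (- (m%:R * t ^+ 2 / (2048 * v ^+ 2))))%:E)%E.
Proof.
move=> mY ind v1 /andP[t0 t1] m2 mgf.
pose S w := \sum_i (Y i w ^+ 2 - 1).
have mS : measurable_fun setT S.
  apply: measurable_sum => i; apply: measurable_funB => //; exact: measurable_funX.
have v2 : 1 <= v ^+ 2 by rewrite expr2; nra.
(* Minimizer of [512 * v ^ 2 * lam ^ 2 - lam * t], with minimum [- t ^ 2 / (2048 * v ^ 2)]. That
   [t <= 1] and [1 <= v] keeps it in the range of [mgf_sqr_centered]. *)
have [lam lamE] : exists lam, lam = t / (1024 * v ^+ 2) by eexists.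
have lam0 : 0 < lam by rewrite lamE; apply: divr_gt0; [exact: t0|lra].
have lamv : lam <= (8 * v)^-1.
  rewrite lamE ler_pdivrMr; last by lra.
  have -> : (8 * v)^-1 * (1024 * v ^+ 2) = 128 * v by field; lra.
  by lra.
have mset s : measurable [set w | lam * (m%:R * t) <= s * S w].
  set E := [set w | _].
  rewrite -[E]setTI; have -> : E = (fun w => s * S w) @^-1` `[lam * (m%:R * t), +oo[.
    by apply/seteqP; split=> w; rewrite /E /= in_itv /= andbT.
  by apply: measurable_funM.
have side s : `|s| = lam -> (P [set w | (lam * (m%:R * t) <= s * S w)%R] <=
    (expR (- (m%:R * t ^+ 2 / (2048 * v ^+ 2))))%:E)%E.
  move=> sl; have ms : measurable_fun setT (fun w => s * S w).
    exact: measurable_funM.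
  apply: le_trans (tail_le_expR P _ ms) _.
  pose f (i : 'I_m) x := expR (s * (x ^+ 2 - 1)).
  have mf i : measurable_fun setT (f i).
    apply: measurableT_comp => //; apply: measurable_funM => //.
    by apply: measurable_funB => //; exact: measurable_funX.
  have fi i : (\int[P]_w (f i (Y i w))%:E <= (expR (512 * v ^+ 2 * s ^+ 2))%:E)%E.
    by apply: mgf_sqr_centered => //; rewrite sl.
  have -> : (\int[P]_w (expR (s * S w))%:E = \int[P]_w (\prod_i f i (Y i w))%:E)%E.
    by apply: eq_integral => w _; rewrite -expR_sum mulr_sumr.
  rewrite independent_integral_prod // => [|i x|i]; last first.
  - by apply: le_lt_trans (fi i) _; exact: ltry.
  - exact: expR_ge0.
  have le : (\prod_i \int[P]_w (f i (Y i w))%:E <=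
      \prod_(i < m) (expR (512 * v ^+ 2 * s ^+ 2))%:E)%E.
    suff /andP[] : (0 <= \prod_i \int[P]_w (f i (Y i w))%:E <=
      \prod_(i < m) (expR (512 * v ^+ 2 * s ^+ 2))%:E)%E by [].
    elim/big_ind2: _ => [|a b a' b' /andP[a0 ab] /andP[a'0 ab']|i _].
    - by rewrite lee01 lexx.
    - by rewrite mule_ge0 //= lee_pmul.
    - by rewrite fi andbT; apply: integral_ge0 => w _; rewrite lee_fin expR_ge0.
  apply: le_trans (lee_wpmul2l _ le) _; first by rewrite lee_fin expR_ge0.
  rewrite prodEFin -expR_sum -EFinM -expRD lee_fin ler_expR.
  rewrite sumr_const card_ord -[_ *+ m]mulr_natl -[s ^+ 2](real_normK (num_real s)) sl.
  rewrite le_eqVlt; apply/orP; left; apply/eqP; rewrite lamE; field; lra.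
have setE : [set w | m%:R * t <= `|S w|] =
    [set w | lam * (m%:R * t) <= lam * S w] `|` [set w | lam * (m%:R * t) <= - lam * S w].
  apply/seteqP; split=> w /=; rewrite mulNr -mulrN !ler_pM2l // ler_normr.
    by move=> /orP.
  by move=> ?; apply/orP.
rewrite -/S setE; split; first by apply: measurableU; exact: mset.
apply: le_trans (measureU2 P (mset _) (mset _)) _.
apply: le_trans (leeD (side lam _) (side (- lam) _)) _.
- by rewrite gtr0_norm.
- by rewrite normrN gtr0_norm.
by rewrite -EFinD lee_fin; lra.
Qed.

Lemma meas2_concentration (R : realType) (dT : measure_display)
    (T : measurableType dT) (P : probability T R) (L : R) (d : nat)
    (n : 'I_d -> nat) (m : nat) (A : 'I_m -> idx n -> T -> R) (u : idx n -> R) (t : R) :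
  subgaussian_ensemble P L A -> (0 < m)%N -> 0 < t <= 1 ->
  exists B : set T, [/\ measurable B,
    (P B <= (2 * expR (- (m%:R * t ^+ 2 / (2048 * (L ^+ 2 + 1) ^+ 2))))%:E)%E &
    forall w, ~ B w -> `|meas2 A w u - fro2 u| <= t * fro2 u].
Proof.
move=> [mA ind A1 A2 sub] m0 t01; pose s := fro2 u.
have t0 : 0 < t by case/andP: t01.
have mR : 0 < m%:R :> R by rewrite ltr0n.
have [s0|sn0] := eqVneq s 0.
  exists set0; split=> [||w _]; first exact: measurable0.
    by rewrite measure0 lee_fin; apply: mulr_ge0; [lra|exact: expR_ge0].
  have u0 j : u j = 0.
    apply/eqP; rewrite -sqrf_eq0; move/eqP: s0; rewrite /s /fro2 psumr_eq0.
      by move=> /allP/(_ j (mem_index_enum j)).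
    by move=> k _; exact: sqr_ge0.
  rewrite -/s s0 mulr0 subr0 /meas2 big1 ?normr0 // => i _.
  by rewrite big1 ?mulr0 ?expr0n // => j _; rewrite u0 mulr0.
have s0 : 0 < s.
  by rewrite lt_neqAle eq_sym sn0; apply: sumr_ge0 => j _; exact: sqr_ge0.
pose c j := u j / Num.sqrt s.
have c1 : \sum_j c j ^+ 2 = 1.
  under eq_bigr do rewrite exprMn exprVn sqr_sqrtr ?(ltW s0) //.
  by rewrite -mulr_suml mulfV.
pose Y i w := \sum_j A i j w * c j.
have mY i : measurable_fun setT (Y i).
  by apply: measurable_sum => j; exact: measurable_funM.
have Yind : mutually_independent P Y by exact: independent_rows.
have Aind i : mutually_independent P (A i) by exact: (independent_row i ind).
have Y2 i : mean P (fun w => Y i w ^+ 2) 1.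
  by rewrite -c1; apply: mean_sqr_sum => //; exact: Aind.
have v1 : 1 <= L ^+ 2 + 1 by rewrite lerDr sqr_ge0.
have mgf i l : (\int[P]_w (expR (l * Y i w))%:E <=
    (expR ((L ^+ 2 + 1) * l ^+ 2 / 2))%:E)%E.
  apply: le_trans (subgaussian_sum c (mA i) (Aind i) (sub i) l) _.
  rewrite c1 mulr1 lee_fin ler_expR ler_wpM2r // ler_wpM2r ?sqr_ge0 //.
  by rewrite lerDl.
have [mB PB] := sum_sqr_centered_tail mY Yind v1 t01 Y2 mgf.
exists [set w | m%:R * t <= `|\sum_i (Y i w ^+ 2 - 1)|].
split=> [||w /= /negP]; [exact: mB|exact: PB|].
rewrite -ltNge => /ltW le.
have -> : meas2 A w u = s / m%:R * \sum_i Y i w ^+ 2.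
  rewrite /meas2 mulr_sumr; apply: eq_bigr => i _.
  rewrite exprMn exprVn sqr_sqrtr ?(ltW mR) // [s / _]mulrC -mulrA; congr (_ * _).
  have -> : \sum_j A i j w * u j = Num.sqrt s * Y i w.
    rewrite /Y mulr_sumr; apply: eq_bigr => j _; rewrite /c mulrCA; congr (_ * _).
    by rewrite mulrCA mulfV ?mulr1 // gt_eqF // sqrtr_gt0.
  by rewrite exprMn sqr_sqrtr ?(ltW s0).
have -> : s / m%:R * \sum_i Y i w ^+ 2 - fro2 u = s / m%:R * \sum_i (Y i w ^+ 2 - 1).
  rewrite sumrB sumr_const card_ord -/s mulrBr; congr (_ - _).
  by rewrite -mulr_natl mulr1 divfK // gt_eqF.
rewrite normrM (gtr0_norm (divr_gt0 s0 mR)) -/s.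
apply: le_trans (ler_wpM2l (ltW (divr_gt0 s0 mR)) le) _.
by rewrite mulrA divfK ?gt_eqF // mulrC.
Qed.

(** * The restricted isometry property *)

(* Replacing [u] and [v] by the representatives of their pieces costs a quarter
   of the supremum of [b] each, so a net of fixed precision controls [b] on [F]. *)
Lemma quantizable_net (R : realType) (J : finType) (F : set (J -> R)) (M : nat)
    (x0 : J -> R) :
  F x0 -> quantizable F 4^-1 M ->
  exists I : finType, exists2 x : I -> J -> R, (#|I| <= M)%N /\ (forall c, F (x c)) &
    forall (b : (J -> R) -> (J -> R) -> R) (D C : R),
    (forall v, exists w, forall u, b u v = dotp w u) ->
    (forall u, exists w, forall v, b u v = dotp w v) ->
    (forall u v, F u -> F v -> `|b u v| <= C) ->
    (forall c c', `|b (x c) (x c')| <= D) ->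
    forall u v, F u -> F v -> `|b u v| <= 2 * D.
Proof.
move=> F0 [I [q cI qP]].
(* Cells that miss [F] receive the default [x0], so that every representative lies in [F]. *)
have ch c : exists u, F u /\ ((exists2 v, F v & q v = c) -> q u = c).
  have [[u Fu qu]|nu] := pselect (exists2 v, F v & q v = c); first by exists u.
  by exists x0; split.
pose x c := projT1 (cid (ch c)).
have Fx c : F (x c) by rewrite /x; case: cid => u [].
have qx u : F u -> q (x (q u)) = q u.
  by move=> Fu; rewrite /x; case: cid => v [_] /= h; apply: h; exists u.
exists I; exists x => // b D C bl br bC bD.
(* The crude bound [C] only serves to make this supremum finite, so that half of it can be
   subtracted from both sides. *)
pose S := [set z | exists u v, [/\ F u, F v & z = `|b u v|]].
have Sub u v : F u -> F v -> `|b u v| <= sup S.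
  move=> Fu Fv; apply: ub_le_sup; last by exists u, v.
  by exists C => _ [u' [v' [Fu' Fv' ->]]]; exact: bC.
suff le u v : F u -> F v -> `|b u v| <= D + 2^-1 * sup S.
  have S2 : sup S <= D + 2^-1 * sup S.
    apply: ge_sup; first by exists `|b x0 x0|, x0, x0.
    by move=> _ [u [v [Fu Fv ->]]]; exact: le.
  by move=> u v Fu Fv; apply: le_trans (Sub u v Fu Fv) _; lra.
move=> Fu Fv.
have [w wP] := bl v; have [w' wP'] := br (x (q u)).
have l1 : `|dotp w u - dotp w (x (q u))| <= 4^-1 * sup S.
  apply: qP => //; first by rewrite qx.
  by move=> f Ff; rewrite -wP; exact: Sub.
have l2 : `|dotp w' v - dotp w' (x (q v))| <= 4^-1 * sup S.
  apply: qP => //; first by rewrite qx.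
  by move=> f Ff; rewrite -wP'; exact: Sub.
have l3 := bD (q u) (q v).
have -> : b u v = b (x (q u)) (x (q v)) +
    (dotp w u - dotp w (x (q u)) + (dotp w' v - dotp w' (x (q v)))).
  by rewrite -!wP -!wP'; ring.
apply: le_trans (ler_normD _ _) _; apply: le_trans (lerD l3 (ler_normD _ _)) _; lra.
Qed.

Lemma measure_union_le (R : realType) (dT : measure_display) (T : measurableType dT)
    (P : probability T R) (I : finType) (B : I -> set T) (p : R) :
  (forall i, measurable (B i)) -> (forall i, P (B i) <= p%:E)%E ->
  exists E : set T, [/\ measurable E, (forall w, E w -> forall i, ~ B i w) &
    (1 - (#|I|%:R * p)%:E <= P E)%E].
Proof.
move=> mB PB; pose U := \bigcup_(i in [set: I]) B i.
have UE : U = \big[setU/set0]_(i <- enum I) B i.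
  by rewrite -bigcup_seq; apply/seteqP; split=> w [i ? ?]; exists i => //=;
    rewrite mem_enum.
have claim (s : seq I) : measurable (\big[setU/set0]_(i <- s) B i) /\
    (P (\big[setU/set0]_(i <- s) B i) <= ((size s)%:R * p)%:E)%E.
  elim: s => [|i s [mU PU]]; first by rewrite big_nil measure0 mul0r; split.
  rewrite big_cons; split; first exact: measurableU.
  apply: le_trans (measureU2 P (mB i) mU) _.
  apply: le_trans (leeD (PB i) PU) _.
  by rewrite -EFinD lee_fin /= -natr1; lra.
have [mU PU] := claim (enum I).
rewrite -UE -cardE in mU PU.
exists (~` U); split; first exact: measurableC.
  by move=> w nU i Bw; apply: nU; exists i.
rewrite probability_setC //; apply: leeB => //.
Qed.

Lemma tric_le (R : realType) (T : Type) (d : nat) (n : 'I_d -> nat) (m : nat)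
    (f : tformat d) (r : {set 'I_d} -> nat) (A : 'I_m -> idx n -> T -> R) (w : T)
    (dl : R) :
  0 <= dl ->
  (forall X, low_rank f r X -> `|meas2 A w X - fro2 X| <= dl * fro2 X) ->
  tric f r A w <= dl.
Proof.
move=> dl0 h; apply: ge_inf; first by exists 0 => z [].
split=> // X lX; have := h X lX; rewrite ler_norml => /andP[h1 h2].
by split; lra.
Qed.

Lemma low_rank_scale (R : realType) (d : nat) (n : 'I_d -> nat) (f : tformat d)
    (r : {set 'I_d} -> nat) (X : idx n -> R) (c : R) :
  low_rank f r X -> low_rank f r (fun i => c * X i).
Proof.
move=> lX t tf; apply: leq_trans (lX t tf); rewrite /mrank.
have -> : matricization t (fun i => c * X i) = c *: matricization t X.
  by apply/matrixP => i j; rewrite !mxE.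
by rewrite mxrankS // scalemx_sub.
Qed.

Lemma low_rank0 (R : realType) (d : nat) (n : 'I_d -> nat) (f : tformat d)
    (r : {set 'I_d} -> nat) :
  low_rank f r (fun _ : idx n => 0 : R).
Proof.
move=> t _; rewrite /mrank; have -> : matricization t (fun _ : idx n => 0 : R) = 0.
  by apply/matrixP => i j; rewrite !mxE.
by rewrite mxrank0.
Qed.

(** A frame with no columns fixes [X], and its projection is zero. *)
Lemma low_rank_rmax0 (R : realType) (d : nat) (n : 'I_d -> nat) (f : tformat d)
    (r : {set 'I_d} -> nat) (X : idx n -> R) :
  (0 < d)%N -> valid_format f -> rmax f r = 0%N -> low_rank f r X -> forall i, X i = 0.
Proof.
move=> d0 vf r0 lX i.
have [t tf] : exists t, t \in format_nodes f.
  case: f vf {r0 lX} => [_|_|T [TT _ _ _ _]] /=; last by exists [set: 'I_d]%SET.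
    by exists [set Ordinal d0]%SET; apply/imsetP; exists (Ordinal d0).
  exists [set Ordinal d0]%SET; rewrite finset.inE; apply/orP; right.
  by apply/imsetP; exists (Ordinal d0).
have rX : (mrank t X <= 0)%N.
  by apply: leq_trans (lX t tf) _; rewrite -r0; exact: leq_bigmax_cond.
have [U [_ _ pU]] := mrank_frame i rX.
have := pU [set: 'I_d]%SET X (finset.subsetT _) (in_spanT X i) i.
rewrite big1 => [/eqP|j _]; last by rewrite big_ord0.
by rewrite mulf_eq0 gt_eqF ?idx_card_gt0 //= => /eqP.
Qed.

(** * The bilinear error form and the union bound *)

Definition gram_error (R : realType) (T : Type) (d : nat) (n : 'I_d -> nat) (m : nat)
    (A : 'I_m -> idx n -> T -> R) (w : T) (X Y : idx n -> R) : R :=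
  m%:R^-1 * (\sum_i (\sum_j A i j w * X j) * (\sum_j A i j w * Y j)) -
  \sum_j X j * Y j.

Lemma gram_error_sym (R : realType) (T : Type) (d : nat) (n : 'I_d -> nat) (m : nat)
    (A : 'I_m -> idx n -> T -> R) (w : T) (X Y : idx n -> R) :
  gram_error A w X Y = gram_error A w Y X.
Proof.
rewrite /gram_error; congr (_ * _ - _); apply: eq_bigr => i _; exact: mulrC.
Qed.

Lemma gram_error_diag (R : realType) (T : Type) (d : nat) (n : 'I_d -> nat) (m : nat)
    (A : 'I_m -> idx n -> T -> R) (w : T) (X : idx n -> R) :
  gram_error A w X X = meas2 A w X - fro2 X.
Proof.
rewrite /gram_error /meas2 /fro2 mulr_sumr; congr (_ - _); apply: eq_bigr => i _.
by rewrite -expr2 exprMn exprVn sqr_sqrtr.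
Qed.

Lemma gram_error_linear (R : realType) (T : Type) (d : nat) (n : 'I_d -> nat) (m : nat)
    (A : 'I_m -> idx n -> T -> R) (w : T) (Y : idx n -> R) :
  exists v : idx n -> R, forall X, gram_error A w X Y = dotp v X.
Proof.
exists (fun j => m%:R^-1 * (\sum_i A i j w * (\sum_k A i k w * Y k)) - Y j) => X.
rewrite /dotp; under eq_bigr do rewrite mulrBl -mulrA mulr_suml.
rewrite sumrB -mulr_sumr exchange_big /=; congr (_ * _ - _); last first.
  by apply: eq_bigr => j _; exact: mulrC.
apply: eq_bigr => i _; rewrite mulr_suml; apply: eq_bigr => j _; ring.
Qed.

Lemma dotpD (R : realType) (J : finType) (v X Y : J -> R) (c : R) :
  dotp v (fun j => X j + c * Y j) = dotp v X + c * dotp v Y.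
Proof.
by rewrite /dotp mulr_sumr -big_split /=; apply: eq_bigr => j _; ring.
Qed.

Lemma gram_error_scale (R : realType) (T : Type) (d : nat) (n : 'I_d -> nat) (m : nat)
    (A : 'I_m -> idx n -> T -> R) (w : T) (X Y : idx n -> R) (c : R) :
  gram_error A w (fun j => c * X j) Y = c * gram_error A w X Y.
Proof.
have [v vP] := gram_error_linear A w Y; rewrite !vP /dotp mulr_sumr.
by apply: eq_bigr => j _; ring.
Qed.

Lemma gram_error_polar (R : realType) (T : Type) (d : nat) (n : 'I_d -> nat) (m : nat)
    (A : 'I_m -> idx n -> T -> R) (w : T) (X Y : idx n -> R) :
  let Z c := fun j => X j + c * Y j in
  4 * gram_error A w X Y =
  gram_error A w (Z 1) (Z 1) - gram_error A w (Z (-1)) (Z (-1)).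
Proof.
have E c : gram_error A w (fun j => X j + c * Y j) (fun j => X j + c * Y j) =
    gram_error A w X X + 2 * c * gram_error A w X Y + c ^+ 2 * gram_error A w Y Y.
  have addl U V Z : gram_error A w (fun j => U j + c * V j) Z =
      gram_error A w U Z + c * gram_error A w V Z.
    by have [v vP] := gram_error_linear A w Z; rewrite !vP dotpD.
  rewrite addl ![gram_error A w _ (fun j => X j + _)]gram_error_sym !addl.
  by rewrite [gram_error A w Y X]gram_error_sym; ring.
by move=> Z; rewrite /Z !E; ring.
Qed.

(** The bound depends on the outcome [w]; it is only used to know that a supremum is finite. *)
Lemma gram_error_bounded (R : realType) (T : Type) (d : nat) (n : 'I_d -> nat) (m : nat)
    (A : 'I_m -> idx n -> T -> R) (w : T) (N : R) :
  exists C, forall X Y, fro2 X <= N -> fro2 Y <= N -> `|gram_error A w X Y| <= C.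
Proof.
exists (m%:R^-1 * (\sum_i (\sum_j A i j w ^+ 2) * N) + N) => X Y XN YN.
have AM (x y B : R) : x ^+ 2 <= B -> y ^+ 2 <= B -> `|x * y| <= B.
  move=> xB yB; rewrite ler_norml; apply/andP; split.
    by have := sqr_ge0 (x + y); nra.
  by have := sqr_ge0 (x - y); nra.
apply: le_trans (ler_normB _ _) _; apply: lerD.
  rewrite normrM ger0_norm ?invr_ge0 //; apply: ler_wpM2l; first by rewrite invr_ge0.
  apply: le_trans (ler_norm_sum _ _ _) _; apply: ler_sum => i _.
  apply: AM; apply: le_trans (sqr_sum_le _ _) _; apply: ler_wpM2l => //;
    by apply: sumr_ge0 => j _; exact: sqr_ge0.
apply: le_trans (ler_norm_sum _ _ _) _.
have : \sum_j `|X j * Y j| <= \sum_j (2^-1 * X j ^+ 2 + 2^-1 * Y j ^+ 2).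
  apply: ler_sum => j _; rewrite ler_norml; apply/andP; split.
    by have := sqr_ge0 (X j + Y j); nra.
  by have := sqr_ge0 (X j - Y j); nra.
rewrite big_split /= -!mulr_sumr -/(fro2 X) -/(fro2 Y); lra.
Qed.

Lemma tric_event (R : realType) (L : R) (d : nat) (n : 'I_d -> nat) (f : tformat d)
    (r : {set 'I_d} -> nat) (dl : R) (m : nat) (dT : measure_display)
    (T : measurableType dT) (P : probability T R) (A : 'I_m -> idx n -> T -> R) :
  idx n -> (2 <= d)%N -> valid_format f -> (0 < rmax f r)%N -> 0 < dl < 1 ->
  subgaussian_ensemble P L A -> (0 < m)%N ->
  exists E : set T, [/\ measurable E, (forall w, E w -> tric f r A w <= dl) &
    (1 - (4 * ((112 * d) ^ format_dim n f r)%:R ^+ 2 *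
      expR (- (m%:R * (dl / 4) ^+ 2 / (2048 * (L ^+ 2 + 1) ^+ 2))))%:E <= P E)%E].
Proof.
move=> i0 d2 vf r0 dl01 ens m0.
have [F [FB qF mF]] := quantizable_low_rank R i0 d2 vf r0.
move: ((112 * d) ^ format_dim n f r)%N qF => M qF.
have N0 := idx_card_gt0 R i0; set N := idx_card R n in N0 FB mF.
have F0 : F (fun=> 0).
  apply: (mF (fun=> 0)); first exact: low_rank0.
  by rewrite big1 ?ltW // => i _; rewrite expr0n.
have [I [x [cI Fx] net]] := quantizable_net F0 qF.
pose flat (U : idx n * unit -> R) i := U (i, tt).
have fB U : F U -> fro2 (flat U) <= N by exact: FB.
pose sgn (s : bool) : R := if s then 1 else -1.
(* Sums and differences of net points. They may leave [F], but concentration holds for every fixed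
   tensor. There are [2 * #|I| ^ 2] of them, each failing with probability at most [2 * q], hence
   the 4 and the square. *)
pose u (p : I * I * bool) i := flat (x p.1.1) i + sgn p.2 * flat (x p.1.2) i.
(* Polarization and the parallelogram law give [t * N] on net pairs; passing to all of [F] doubles
   it to [dl * N / 2]. *)
pose t := dl / 4.
have t01 : 0 < t <= 1 by case/andP: dl01 => *; rewrite /t; apply/andP; split; lra.
have /choice[B BP] p := meas2_concentration (u p) ens m0 t01.
rewrite -/t; set q := expR _ in BP *.
have q0 : 0 <= q by exact: expR_ge0.
clearbody q.
have mB p : measurable (B p) by case: (BP p).
have PB p : (P (B p) <= (2 * q)%:E)%E by case: (BP p).
have [E [mE EB PE]] := measure_union_le mB PB.
exists E; split=> //; last first.
  apply: le_trans PE; apply: leeB => //; rewrite lee_fin.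
  rewrite !card_prod card_bool !natrM.
  have cM : #|I|%:R <= M%:R :> R by rewrite ler_nat.
  have : #|I|%:R * #|I|%:R <= M%:R ^+ 2 :> R by rewrite expr2 ler_pM.
  move=> le; have := ler_wpM2r q0 le; lra.
move=> w Ew; apply: tric_le; first by case/andP: dl01 => /ltW.
have rip p : `|gram_error A w (u p) (u p)| <= t * fro2 (u p).
  by rewrite gram_error_diag; case: (BP p) => _ _; apply; exact: EB.
pose b U V := gram_error A w (flat U) (flat V).
have lin V : exists v, forall U, b U V = dotp v U.
  have [v vP] := gram_error_linear A w (flat V).
  exists (fun p => v p.1) => U; rewrite /b vP /dotp sum_pair; apply: eq_bigr => i _.
  by rewrite (big_pred1 tt) // => -[].
have linr U : exists v, forall V, b U V = dotp v V.
  have [v vP] := lin U; exists v => V; rewrite -vP /b; exact: gram_error_sym.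
have [C CP] := gram_error_bounded A w N.
have bC U V : F U -> F V -> `|b U V| <= C by move=> FU FV; apply: CP; exact: fB.
have bx c c' : `|b (x c) (x c')| <= t * N.
  have := gram_error_polar A w (flat (x c)) (flat (x c')).
  have := rip (c, c', true); have := rip (c, c', false).
  rewrite /u /sgn /= -/(b (x c) (x c')).
  set g1 := gram_error _ _ _ _; set g2 := gram_error _ _ _ _ => h2 h1 pol.
  have par : fro2 (fun i => flat (x c) i + -1 * flat (x c') i) +
      fro2 (fun i => flat (x c) i + 1 * flat (x c') i) =
      2 * fro2 (flat (x c)) + 2 * fro2 (flat (x c')).
    rewrite /fro2 -big_split /= !mulr_sumr -big_split /=.
    by apply: eq_bigr => i _; ring.
  have le1 := fB _ (Fx c); have le2 := fB _ (Fx c').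
  have t0 : 0 <= t by case/andP: t01 => /ltW.
  have le := ler_wpM2l t0 (lerD le1 le2).
  have tri : `|4 * b (x c) (x c')| <= `|g2| + `|g1| by rewrite pol ler_normB.
  rewrite normrM (ger0_norm (_ : 0 <= 4)) // in tri.
  have {}par := congr1 (fun z => t * z) par; rewrite !mulrDr in par.
  rewrite mulrDr in le; nra.
have bF := net b (t * N) C lin linr bC bx.
move=> X lX; rewrite -gram_error_diag.
have [s0|sn0] := eqVneq (fro2 X) 0.
  have X0 j : X j = 0.
    apply/eqP; rewrite -sqrf_eq0; move/eqP: s0; rewrite /fro2 psumr_eq0.
      by move=> /allP/(_ j (mem_index_enum j)).
    by move=> k _; exact: sqr_ge0.
  have [v vP] := gram_error_linear A w X.
  by rewrite vP /dotp big1 ?normr0 ?s0 ?mulr0 // => j _; rewrite X0 mulr0.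
have s0 : 0 < fro2 X.
  by rewrite lt_neqAle eq_sym sn0; apply: sumr_ge0 => j _; exact: sqr_ge0.
(* Scaling [X] to squared norm [N] puts it into [F]; the error form is homogeneous of degree two. *)
pose c := Num.sqrt (N / fro2 X).
have c2 : c * c = N / fro2 X by rewrite -expr2 sqr_sqrtr // divr_ge0 ?ltW.
pose Z (iu : idx n * unit) := c * X iu.1.
have FZ : F Z.
  apply: (mF (fun i => c * X i)); first exact: low_rank_scale.
  under eq_bigr do rewrite exprMn.
  by rewrite -mulr_sumr expr2 c2 -/(fro2 X) divfK.
have := bF _ _ FZ FZ.
have -> : b Z Z = N / fro2 X * gram_error A w X X.
  rewrite /b /flat /Z gram_error_scale gram_error_sym gram_error_scale mulrA c2.
  by [].
rewrite normrM gtr0_norm ?divr_gt0 // mulrAC ler_pdivrMr // => le.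
rewrite -(ler_pM2l N0); apply: le_trans le _.
rewrite /t; have : 0 <= N * dl * fro2 X.
  by rewrite !mulr_ge0 ?ltW //; case/andP: dl01.
lra.
Qed.

Lemma tric_le_of_zero (R : realType) (T : Type) (d : nat) (n : 'I_d -> nat) (m : nat)
    (f : tformat d) (r : {set 'I_d} -> nat) (A : 'I_m -> idx n -> T -> R) (w : T)
    (dl : R) :
  0 <= dl -> (forall X : idx n -> R, low_rank f r X -> forall i, X i = 0) ->
  tric f r A w <= dl.
Proof.
move=> dl0 X0; apply: tric_le => // X lX; rewrite /meas2 /fro2 !big1 => [|j _|i _].
- by rewrite subrr normr0 mulr0.
- by rewrite (X0 X lX) expr0n.
- by rewrite big1 ?mulr0 ?expr0n // => j _; rewrite (X0 X lX) mulr0.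
Qed.

Lemma format_dim_gt0 (d : nat) (n : 'I_d -> nat) (f : tformat d)
    (r : {set 'I_d} -> nat) :
  (2 <= d)%N -> (0 < rmax f r)%N -> (0 < format_dim n f r)%N.
Proof.
move=> d2; case: f => [||T] r0; rewrite /format_dim addn_gt0.
- by rewrite expn_gt0 r0.
- by rewrite muln_gt0 subn_gt0 d2 expn_gt0 r0.
- by rewrite muln_gt0 subn_gt0 d2 expn_gt0 r0.
Qed.

Lemma sample_bound_ge (R : realType) (d : nat) (n : 'I_d -> nat) (f : tformat d)
    (r : {set 'I_d} -> nat) (C dl eps : R) :
  0 <= C -> (2 <= d)%N -> (0 < rmax f r)%N ->
  C / dl ^+ 2 * Num.max ((format_dim n f r)%:R * ln d%:R) (ln eps^-1) <=
  sample_bound n f r C C dl eps.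
Proof.
move=> C0 d2; have Cd0 : 0 <= C / dl ^+ 2 by rewrite divr_ge0 ?sqr_ge0.
have d0 : 0 < d%:R :> R by rewrite ltr0n ltnW.
have lnM r' : (0 < r')%N -> ln (d%:R : R) <= ln (d * r')%:R.
  move=> r0; rewrite ler_ln ?posrE // ?ler_nat ?leq_pmulr //.
  by rewrite ltr0n muln_gt0 r0 ltnW.
have tree D r' : (0 < r')%N -> C / dl ^+ 2 * Num.max (D%:R * ln d%:R) (ln eps^-1) <=
    C / dl ^+ 2 * Num.max (D%:R * ln (d * r')%:R) (ln eps^-1).
  move=> r0; apply: ler_wpM2l => //; rewrite ge_max !le_max lexx orbT andbT.
  by rewrite ler_wpM2l ?lnM.
by case: f => [||T] r0 //; exact: tree.
Qed.

(** [19 = 2 + 16 + 1]. With [2 <= d], [4 <= d ^ 2] costs 2, and [112 <= 2 ^ 7] gives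
    [112 * d <= d ^ 8], whose square costs 16; the last unit pays for [eps]. *)
Lemma union_bound_le (R : realType) (d D : nat) (y eps : R) :
  (2 <= d)%N -> (0 < D)%N -> 0 < eps < 1 ->
  19 * Num.max (D%:R * ln d%:R) (ln eps^-1) <= y ->
  4 * ((112 * d) ^ D)%:R ^+ 2 * expR (- y) <= eps.
Proof.
move=> d2 D0 /andP[eps0 eps1] yX.
have dR : 2 <= d%:R :> R by rewrite ler_nat.
have d0 : 0 < d%:R :> R by lra.
set l := ln (d%:R : R) in yX *.
have el : expR l = d%:R by rewrite /l lnK ?posrE.
have l0 : 0 <= l by rewrite ln_ge0 //; lra.
have D1 : 1 <= D%:R :> R by rewrite ler1n.
set X := Num.max _ _ in yX.
have X1 : D%:R * l <= X by rewrite le_max lexx.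
have X2 : ln eps^-1 <= X by rewrite le_max lexx orbT.
have e4 : 4 <= expR (2 * l).
  have -> : 2 * l = l + l by ring.
  by rewrite expRD el; nra.
have eM : ((112 * d) ^ D)%:R <= expR (8 * (D%:R * l)) :> R.
  have -> : 8 * (D%:R * l) = D%:R * (8 * l) by ring.
  rewrite natrX expRM_natl; apply: lerXn2r; rewrite ?nnegrE ?expR_ge0 //.
  rewrite expRM_natl el natrM exprS mulrC (ler_pM2l d0).
  have h : (2 : R) ^+ 7 <= d%:R ^+ 7 by apply: lerXn2r; rewrite ?nnegrE.
  apply: le_trans h; have -> : (2 : R) ^+ 7 = 128 by ring.
  lra.
have M0 : 0 <= ((112 * d) ^ D)%:R :> R by [].
have eM2 : ((112 * d) ^ D)%:R ^+ 2 <= expR (16 * (D%:R * l)) :> R.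
  have -> : 16 * (D%:R * l) = 8 * (D%:R * l) + 8 * (D%:R * l) by ring.
  by rewrite expRD expr2 ler_pM.
have e0 := expR_ge0 (- y).
apply: (@le_trans _ _ (expR (2 * l) * expR (16 * (D%:R * l)) * expR (- y))).
  by apply: ler_wpM2r => //; apply: ler_pM => //; exact: sqr_ge0.
rewrite -!expRD.
have <- : expR (- ln eps^-1) = eps.
  by rewrite expRN lnK ?posrE ?invr_gt0 // invrK.
rewrite ler_expR; have : l <= D%:R * l by rewrite ler_peMl.
lra.
Qed.

Unset Implicit Arguments.
Set Strict Implicit.

Theorem theorem2 (R : realType) (L : R) :
  exists C1 C2 : R, 0 < C1 /\ 0 < C2 /\
  forall (d : nat) (n : 'I_d -> nat) (f : tformat d) (r : {set 'I_d} -> nat)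
         (dl eps : R) (m : nat) (dT : measure_display) (T : measurableType dT)
         (P : probability T R) (A : 'I_m -> idx n -> T -> R),
    (2 <= d)%N -> valid_format f ->
    0 < dl < 1 -> 0 < eps < 1 ->
    subgaussian_ensemble P L A ->
    sample_bound n f r C1 C2 dl eps <= m%:R ->
    exists E : set T, [/\ measurable E,
      E `<=` [set w | tric f r A w <= dl] &
      (1 - eps%:E <= P E)%E].
Proof.
have v0 : 0 < (L ^+ 2 + 1) ^+ 2.
  by rewrite exprn_gt0 // ltr_wpDl ?sqr_ge0.
(* The 16 comes from the square of [dl / 4], the rest from the tail bound with [v = L ^+ 2 + 1]. *)
pose K := 16 * (2048 * (L ^+ 2 + 1) ^+ 2).
have K0 : 0 < K by apply: mulr_gt0; [lra|apply: mulr_gt0; [lra|exact: v0]].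
have KE : K = 16 * (2048 * (L ^+ 2 + 1) ^+ 2) := erefl.
clearbody K.
pose C := 19 * K; have C0 : 0 < C by rewrite /C; lra.
have CE : C = 19 * K := erefl.
clearbody C.
exists C, C; split=> //; split=> // d n f r dl eps m dT T P A d2 vf dl01 eps01 ens mb.
have dl0 : 0 < dl by case/andP: dl01.
have eps0 : 0 < eps by case/andP: eps01.
have trivial_case : (forall X : idx n -> R, low_rank f r X -> forall i, X i = 0) ->
    exists E : set T, [/\ measurable E,
      E `<=` [set w | tric f r A w <= dl] & (1 - eps%:E <= P E)%E].
  move=> X0; exists setT; split=> [//|w _|].
    by apply: tric_le_of_zero X0; exact: ltW.
  by rewrite probability_setT -EFinB lee_fin; lra.
(* With an empty index type, or with all ranks zero, only the zero tensor qualifies. Otherwise a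
   base index and a positive rank are at hand, as the event construction requires. *)
have [[i0 _]|noi] := pselect (exists i : idx n, True); last first.
  by apply: trivial_case => X _ i; case: noi; exists i.
have [r0|r0] := posnP (rmax f r).
  by apply: trivial_case => X; apply: low_rank_rmax0 => //; exact: ltnW.
have X0 : 0 < ln eps^-1.
  by rewrite ln_gt0 // invf_gt1 //; case/andP: eps01.
have mX := le_trans (sample_bound_ge n dl eps (ltW C0) d2 r0) mb.
set X := Num.max _ _ in mX.
have XX : 0 < X by rewrite lt_max X0 orbT.
have m0 : (0 < m)%N.
  rewrite -(ltr0n R); apply: lt_le_trans mX; apply: mulr_gt0 => //.
  by rewrite divr_gt0 // exprn_gt0.
have [E [mE EP PE]] := tric_event i0 d2 vf r0 dl01 ens m0.
exists E; split=> //; apply: le_trans PE; apply: leeB => //; rewrite lee_fin.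
apply: union_bound_le => //; first exact: format_dim_gt0.
rewrite -/X.
have -> : m%:R * (dl / 4) ^+ 2 / (2048 * (L ^+ 2 + 1) ^+ 2) = m%:R * dl ^+ 2 / K.
  by rewrite KE; field; rewrite gt_eqF // ltr_wpDl ?sqr_ge0.
rewrite ler_pdivlMr //.
have := ler_wpM2r (ltW (exprn_gt0 2 dl0)) mX.
have -> : C / dl ^+ 2 * X * dl ^+ 2 = 19 * X * K.
  by rewrite CE; field; rewrite gt_eqF.
by [].
Qed.
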